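(* Let $n \ge 1$ and $r \ge 1$ be integers, let $V=\{1,2,\dots,n\}$, and let $(2^V)^{\langle r\rangle}$ denote the $r$th edgewise subdivision of the $(n-1)$-dimensional simplex $2^V$ (defined in the context). Then the local $h$-polynomial of $(2^V)^{\langle r\rangle}$ satisfies \[ \ell_V\big((2^V)^{\langle r \rangle}, x\big) \;=\; \mathrm{E}_r\, (x + x^2 + \cdots + x^{r-1})^n \;=\; \sum_{w \in \mathcal{SW}(n, r)} x^{\mathrm{asc}(w)} \;=\; \sum_{i=0}^{\lfloor n/2 \rfloor} \xi_{n, r, i} \, x^i (1+x)^{n-2i}, \] where $\mathrm{asc}(w)$ is the number of ascents of $w$, and $\xi_{n,r,i}$ is the number of words $w=(w_0,w_1,\dots,w_n)\in \mathcal{SW}(n,r)$ with exactly $i$ ascents which have the following property: for every double ascent $j$ of $w$ there exists a double descent $k>j$ of $w$ such that $w_j=w_k$ and $w_j \le w_m$ for all $m$ with $j<m<k$.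
   Context: For a $(d-1)$-dimensional simplicial complex $\Delta$ with $f_{i}(\Delta)$ faces of dimension $i$ (so $f_{-1}=1$ for the empty face), its $h$-polynomial is $h(\Delta,x)=\sum_{i=0}^{d} f_{i-1}(\Delta)\,x^i(1-x)^{d-i}$. Edgewise subdivision: let $V=\{1,\dots,n\}$. Let $V_r$ be the set of vectors $a=(a_1,\dots,a_n)$ of nonnegative integers with $a_1+\cdots+a_n=r$; for such $a$ put $\iota(a)=(a_1,\,a_1+a_2,\,\dots,\,a_1+\cdots+a_n)\in\mathbb{Z}^n$ and $\mathrm{supp}(a)=\{i: a_i\neq 0\}$. The $r$th edgewise subdivision $(2^V)^{\langle r\rangle}$ is the simplicial complex on vertex set $V_r$ whose faces are the subsets $E\subseteq V_r$ such that for all $a,b\in E$, either $\iota(a)-\iota(b)\in\{0,1\}^n$ or $\iota(b)-\iota(a)\in\{0,1\}^n$. It is a (geometric) subdivision of $2^V$ with carrier map $E\mapsto \bigcup_{a\in E}\mathrm{supp}(a)$; for $F\subseteq V$ its restriction $\Gamma_F$ is the subcomplex of faces $E$ with $\bigcup_{a\in E}\mathrm{supp}(a)\subseteq F$ (so $\Gamma_\varnothing=\{\varnothing\}$ with $h=1$, and $\Gamma_F$ has dimension $|F|-1$). Local $h$-polynomial: for a subdivision $\Gamma$ of $2^V$ with restrictions $\Gamma_F$, $\ell_V(\Gamma,x)=\sum_{F\subseteq V}(-1)^{n-|F|}\,h(\Gamma_F,x)$, where $h(\Gamma_F,x)$ is computed with $d=|F|$. $\mathrm{E}_r$ is the linear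 operator on $\mathbb{R}[x]$ with $\mathrm{E}_r(x^m)=x^{m/r}$ if $r$ divides $m$ and $\mathrm{E}_r(x^m)=0$ otherwise. $\mathcal{SW}(n,r)$ is the set of words $w=(w_0,w_1,\dots,w_n)\in\{0,1,\dots,r-1\}^{n+1}$ with $w_0=w_n=0$ and no two consecutive entries equal ($w_{i}\ne w_{i+1}$ for $0\le i\le n-1$). An index $i\in\{0,\dots,n-1\}$ is an ascent of $w$ if $w_i<w_{i+1}$. An index $i\in\{1,\dots,n-1\}$ is a double ascent if $w_{i-1}<w_i<w_{i+1}$, and a double descent if $w_{i-1}>w_i>w_{i+1}$. *)

(* Defs.v *)
From mathcomp Require Import all_boot all_order all_algebra.
From mathcomp Require Import reals.

Set Implicit Arguments.
Unset Strict Implicit.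
Unset Printing Implicit Defensive.

Import Order.TTheory GRing.Theory Num.Theory.

Local Open Scope ring_scope.

(* A complex on the finite vertex type T is given by its set of faces;
   [nfaces Delta i] is f_{i-1}(Delta), the number of faces with i vertices. *)
Definition nfaces (T : finType) (Delta : {set {set T}}) (i : nat) : nat :=
  #|[set E in Delta | #|E| == i]|.

(* [d] is one more than the dimension of Delta. *)
Definition hpoly (R : realType) (T : finType) (d : nat) (Delta : {set {set T}}) :
    {poly R} :=
  \sum_(i < d.+1) (nfaces Delta i)%:R *: ('X^i * (1 - 'X) ^+ (d - i)).

Section Subdivision.

Variables (V T : finType) (Gamma : {set {set T}}) (carrier : {set T} -> {set V}).

Definition restriction (F : {set V}) : {set {set T}} :=
  [set E in Gamma | carrier E \subset F].

Definition local_hpoly (R : realType) : {poly R} :=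
  \sum_(F : {set V}) (-1) ^+ (#|V| - #|F|) * hpoly R #|F| (restriction F).

End Subdivision.

Section Edgewise.

Variables n r : nat.

(* Nonnegative integer vectors with sum r; the entries are then at most r,
   so nothing is lost by bounding them. *)
Definition Vr := {a : {ffun 'I_n -> 'I_r.+1} | (\sum_i a i)%N == r}.

Definition iota_vec (a : Vr) (i : 'I_n) : int :=
  \sum_(j < n | (j <= i)%N) (val a j)%:Z.

Definition supp (a : Vr) : {set 'I_n} := [set i | val a i != 0%N :> nat].

Definition diff01 (a b : Vr) : bool :=
  [forall i, iota_vec a i - iota_vec b i \in [:: 0; 1]].

Definition edgewise : {set {set Vr}} :=
  [set E : {set Vr} |
    [forall a in E, forall b in E, diff01 a b || diff01 b a]].

Definition edgewise_carrier (E : {set Vr}) : {set 'I_n} :=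
  \bigcup_(a in E) supp a.

End Edgewise.

Definition Eop (R : realType) (r : nat) (p : {poly R}) : {poly R} :=
  \sum_(m < size p) p`_m *: (if (r %| m)%N then 'X^(m %/ r) else 0).

Lemma Eop_wide (R : realType) (r N : nat) (p : {poly R}) : (size p <= N)%N ->
  Eop r p = \sum_(m < N) p`_m *: (if (r %| m)%N then 'X^(m %/ r) else 0).
Proof.
move=> le_pN; rewrite /Eop.
rewrite (big_ord_widen N
  (fun m => p`_m *: (if (r %| m)%N then 'X^(m %/ r) else 0)) le_pN).
rewrite big_mkcond; apply: eq_bigr => i _.
by case: ltnP => // /(nth_default 0) ->; rewrite scale0r.
Qed.

Lemma Eop_linear (R : realType) (r : nat) : linear (@Eop R r).
Proof.
move=> c p q; pose N := maxn (size (c *: p + q)) (maxn (size p) (size q)).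
rewrite !(@Eop_wide _ _ N) ?leq_max ?leqnn ?orbT // scaler_sumr -big_split.
by apply: eq_bigr => i _; rewrite /= coefD coefZ scalerDl scalerA.
Qed.

Lemma EopXn (R : realType) (r m : nat) :
  Eop r ('X^m : {poly R}) = if (r %| m)%N then 'X^(m %/ r) else 0.
Proof.
rewrite /Eop size_polyXn big_ord_recr /= coefXn eqxx scale1r big1 ?add0r //.
by move=> i _; rewrite coefXn ltn_eqF // scale0r.
Qed.

Section Words.

Variables n r : nat.

Implicit Type w : n.+1.-tuple 'I_r.

(* [letter w i] is w_i; it is only used for i <= n. *)
Definition letter w (i : nat) : nat := nth 0%N [seq val x | x <- w] i.

Definition SW : {set n.+1.-tuple 'I_r} :=
  [set w | [&& letter w 0 == 0%N, letter w n == 0%N &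
               [forall i : 'I_n, letter w i != letter w i.+1]]].

Definition asc w : nat := #|[set i : 'I_n | (letter w i < letter w i.+1)%N]|.

Definition double_ascent w (i : 'I_n) : bool :=
  [&& 0 < i, letter w i.-1 < letter w i & letter w i < letter w i.+1]%N.

Definition double_descent w (i : 'I_n) : bool :=
  [&& 0 < i, letter w i < letter w i.-1 & letter w i.+1 < letter w i]%N.

Definition xi_word w : bool :=
  [forall j, double_ascent w j ==>
    [exists k, [&& double_descent w k, (j < k)%N, letter w j == letter w k &
      [forall m : 'I_n, (j < m < k)%N ==> (letter w j <= letter w m)%N]]]].

Definition xi (i : nat) : nat := #|[set w in SW | (asc w == i) && xi_word w]|.

End Words.

(* Main.v *)
(** Local h-polynomial. A face E with k vertices of the subdivision of a simplex
    with d vertices is a chain of vectors whose prefix sums differ by 0 or 1, so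
    it is determined by the sums over E of these prefix sums: a weakly increasing
    sequence from 0 to r k, of length d, which hits every residue mod k.
    Transposing the indices of an r x k array and sorting turns these sequences
    into weakly increasing ones which never skip a block of length r. Splitting
    off the first step shows that the numbers of such sequences satisfy the
    recursion of the polynomials E_r (x^w (1 + ... + x^(r-1))^d), whence
    h(Gamma_F) = E_r ((1 + ... + x^(r-1))^|F|); inclusion-exclusion over F follows.

    Words. The letters of a word encode exponents mod r, and an ascent is a
    passage through a multiple of r: both sides satisfy the same recursion.

    Gamma expansion. Words over the letters >= h, surrounded by smaller letters,
    are cut at the occurrences of h. If h is the first but not the last letter,
    the first h is an unmatched double ascent; if it is the last but not the first
    letter, the last h is an unmatched double descent. These two cases have the
    same generating function up to a factor x, which is merged into the factor
    1 + x; all other cases are the same for good words as for all words. *)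

From HB Require Import structures.
Require Import Defs.
From mathcomp Require Import all_boot all_order all_algebra.
From mathcomp Require Import reals zify ring.

Set Implicit Arguments.
Unset Strict Implicit.
Unset Printing Implicit Defensive.

Import GRing.Theory.

(** * Words over an alphabet *)

Fixpoint words (T : Type) (A : seq T) (L : nat) : seq (seq T) :=
  if L is L'.+1 then [seq a :: v | a <- A, v <- words A L'] else [:: [::]].

Lemma mem_words (T : eqType) (A : seq T) L v :
  (v \in words A L) = (size v == L) && all (mem A) v.
Proof.
elim: L v => [|L IH] v /=; first by case: v.
apply/allpairsP/idP => [[[a u] /= [aA uL ->]]|].
  by move: uL; rewrite IH /= eqSS => /andP[-> ->]; rewrite aA.
case: v => [//|a u] /= /andP[]; rewrite eqSS => su /andP[aA uA].
by exists (a, u); rewrite IH su uA.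
Qed.

Lemma words_uniq (T : eqType) (A : seq T) L : uniq A -> uniq (words A L).
Proof.
move=> uA; elim: L => [//|L IH] /=.
by apply: allpairs_uniq => // -[a u] [b v] _ _ /= [-> ->].
Qed.

Lemma size_words_mem (T : eqType) (A : seq T) L v : v \in words A L -> size v = L.
Proof. by rewrite mem_words => /andP[/eqP]. Qed.

Lemma words_all (T : eqType) (A : seq T) L v : v \in words A L -> all (mem A) v.
Proof. by rewrite mem_words => /andP[]. Qed.

Lemma big_wordsS (T : Type) (M : nmodType) (A : seq T) L (F : seq T -> M) :
  (\sum_(v <- words A L.+1) F v = \sum_(a <- A) \sum_(v <- words A L) F (a :: v))%R.
Proof. by rewrite /= big_allpairs_dep. Qed.

(** Words are sorted by the position p at which h is first chosen: before it only letters of A are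
    used, after it every letter is allowed. *)
Lemma big_words_cons (T : Type) (M : nmodType) (h : T) (A : seq T) L
    (F : seq T -> M) :
  (\sum_(v <- words (h :: A) L) F v = \sum_(v <- words A L) F v +
     \sum_(p < L) \sum_(u <- words A p) \sum_(s <- words (h :: A) (L - p).-1)
        F (u ++ h :: s))%R.
Proof.
elim: L F => [|L IH] F; first by rewrite big_ord0 addr0.
rewrite !big_wordsS big_cons big_ord_recl /= big_seq1 /= addrCA; congr (_ + _)%R.
transitivity (\sum_(a <- A) (\sum_(v <- words A L) F (a :: v) +
   \sum_(p < L) \sum_(u <- words A p) \sum_(s <- words (h :: A) (L - p).-1)
        F (a :: u ++ h :: s)))%R.
  by apply: eq_bigr => a _; rewrite IH.
rewrite big_split /=; congr (_ + _)%R.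
rewrite exchange_big /=; apply: eq_bigr => p _.
by rewrite /bump /= add1n subSS (big_wordsS _ p).
Qed.

Lemma big_tuple_words (M : nmodType) n r (F : seq nat -> M) :
  (\sum_(w : n.-tuple 'I_r) F [seq val x | x <- w] =
     \sum_(s <- words (iota 0 r) n) F s)%R.
Proof.
rewrite -(big_map (fun w : n.-tuple 'I_r => [seq val x | x <- w]) xpredT F).
apply: perm_big; apply: uniq_perm.
- rewrite map_inj_uniq ?index_enum_uniq // => u v /inj_map e.
  by apply: val_inj; apply: e; apply: val_inj.
- by rewrite words_uniq ?iota_uniq.
move=> s; rewrite mem_words; apply/mapP/andP => [[w _ ->]|[/eqP ss As]].
  rewrite size_map size_tuple eqxx; split=> //.
  by apply/allP => _ /mapP[x _ ->] /=; rewrite mem_iota add0n ltn_ord.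
have sz : size (pmap (insub : nat -> option 'I_r) s) == n.
  rewrite size_pmap_sub -ss -all_count.
  by apply: sub_all As => x /=; rewrite mem_iota.
exists (Tuple sz); rewrite ?mem_index_enum //=.
rewrite (pmap_filter (@insubK _ _ _)); apply/esym/all_filterP.
by apply: sub_all As => x /=; rewrite mem_iota => h; rewrite /= insubT.
Qed.

(** * Good words and their ascents *)

Notation neqn := (fun a b : nat => a != b).

Fixpoint asc_from (c : nat) (s : seq nat) : nat :=
  if s is d :: s' then (c < d) + asc_from d s' else 0.

(* In the word s read after the letter p, the first letter smaller than h is
   directly preceded by h. *)
Fixpoint exits (h p : nat) (s : seq nat) : bool :=
  if s is c :: s' then if c < h then p == h else exits h c s' else false.

(* Every double ascent of the word p :: s is matched by a double descent, as in
   [xi_word]. *)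
Fixpoint good (p : nat) (s : seq nat) : bool :=
  if s is c :: s' then ((p < c) && (c < head 0 s') ==> exits c c s') && good c s'
  else true.

Lemma asc_from_cat c u s :
  asc_from c (u ++ s) = asc_from c u + asc_from (last c u) s.
Proof. by elim: u c => [|d u IH] c //=; rewrite IH addnA. Qed.

Lemma asc_from_low q u : all (ltn q) u -> asc_from q u = asc_from 0 u.
Proof. by case: u => [|c u] //= /andP[qc _]; rewrite qc (leq_ltn_trans _ qc). Qed.

Lemma path_neq_low q u : all (ltn q) u -> path neqn q u = path neqn 0 u.
Proof.
case: u => [|c u] //= /andP[qc _].
by rewrite (ltn_eqF qc) (ltn_eqF (leq_ltn_trans _ qc)).
Qed.

(** The scan stops at the first letter below h, so nothing after q matters and 0 can stand for any
    such q. *)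
Lemma exits_cat h p u q s : q < h -> exits h p (u ++ q :: s) = exits h p (u ++ [:: 0]).
Proof.
move=> qh; elim: u p => [|c u IH] p /=; first by rewrite qh (leq_ltn_trans _ qh).
by rewrite IH.
Qed.

Lemma exits_last h p s : 0 < h -> all (leq h) s ->
  exits h p (s ++ [:: 0]) = (last p s == h).
Proof.
move=> h0; elim: s p => [|c s IH] p /=; first by rewrite h0.
by move=> /andP[hc hs]; rewrite ltnNge hc /= IH.
Qed.

(** All letters of [c :: u] exceed q, so each of their double ascents is decided at q at the latest,
    while q itself is entered by a descent. *)
Lemma good_cat_above c u q s : all (ltn q) (c :: u) ->
  good c (u ++ q :: s) = good c (u ++ [:: 0]) && good q s.
Proof.
elim: u c => [|d u IH] c /=.
  by rewrite andbT => qc; rewrite ltnNge (ltnW qc).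
move=> /and3P[qc qd qu]; rewrite exits_cat // IH /= ?qd // andbA.
congr (_ && _ && _); case: u {IH} qu => [|e u] //= _.
by rewrite (ltnNge d q) (ltnW qd) ltn0.
Qed.

Lemma good_cat p u q s : u != [::] -> all (ltn p) u -> all (ltn q) u ->
  good p (u ++ q :: s) = good 0 (u ++ [:: 0]) && good q s.
Proof.
case: u => [//|c u] _ /andP[/= pc _] qu; have /andP[/= qc _] := qu.
rewrite /= pc (leq_ltn_trans _ pc) //= good_cat_above // andbA; congr (_ && _ && _).
rewrite exits_cat //; case: u {qu} => [|e u] //=.
by rewrite (ltnNge c q) (ltnW qc).
Qed.

Lemma first_occ (h : nat) (s : seq nat) : h \in s ->
  exists u s' : seq nat, s = u ++ h :: s' /\ h \notin u.
Proof.
elim: s => [//|c s IH]; rewrite inE; have [->|nch /=] := eqVneq h c.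
  by exists [::], s.
move=> /IH[u [s' [-> hu]]]; exists (c :: u), s'; split=> //.
by rewrite inE negb_or nch.
Qed.

Lemma min_letter (v : seq nat) : v != [::] -> exists2 h : nat, h \in v & all (leq h) v.
Proof.
elim: v => [//|c [|d v] IH] _; first by exists c; rewrite ?mem_head //= leqnn.
have [//|h hv hl] := IH; have [ch|hc] := leqP c h.
  exists c; rewrite ?mem_head //=; rewrite leqnn.
  by apply: sub_all hl => x; apply: leq_trans.
exists h; first by rewrite inE hv orbT.
by apply/andP; split=> //; apply: ltnW.
Qed.

Lemma all_leq_ltn h u : all (leq h) u -> h \notin u -> all (ltn h) u.
Proof.
move=> /allP hu hnu; apply/allP => x xu /=.
rewrite ltn_neqAle hu // andbT; apply: contraNneq hnu => ->; exact: xu.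
Qed.

Lemma last_above h u : u != [::] -> all (ltn h) u -> last h u != h.
Proof.
case: u => [//|c u] _ /allP hu /=.
by rewrite gtn_eqF //; apply: hu; rewrite mem_last.
Qed.

Lemma path_neq_cat h u s : u != [::] -> all (ltn h) u ->
  path neqn h (u ++ h :: s) = path neqn 0 u && path neqn h s.
Proof. by move=> u0 hu; rewrite cat_path /= last_above // path_neq_low. Qed.

(* The first letter of h :: s is matched iff the word comes back to h just
   before it drops below h. *)
Lemma good_cons_min h s : 0 < h -> all (leq h) s -> path neqn h s ->
  good 0 (h :: s ++ [:: 0]) = (last h s == h) && good h (s ++ [:: 0]).
Proof.
move=> h0 hs ps; rewrite /= h0 exits_last //=.
case: s hs ps => [|c s] /=; first by rewrite eqxx.
by move=> /andP[hc _] /andP[nhc _]; rewrite ltn_neqAle nhc hc.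
Qed.

(** Cutting at the first occurrence of the lowest letter leaves shorter words of both kinds, so both
    bounds go through one strong induction. The right-hand sides count steps, including those from
    and to the surrounding smaller letters; the bounds later keep the exponents [n - 2 * a] from
    truncating. *)
Lemma good_asc_bound m :
  (forall v : seq nat, size v = m -> v != [::] -> all (leq 1) v -> path neqn 0 v ->
     good 0 (v ++ [:: 0]) -> 2 * asc_from 0 v <= m.+1) /\
  (forall h s, size s = m -> all (leq h) s -> path neqn h s ->
     good h (s ++ [:: 0]) -> 2 * asc_from h s <= m + (last h s != h)).
Proof.
elim/ltn_ind: m => m IH; pose P m' := forall v : seq nat, size v = m' -> v != [::] ->
  all (leq 1) v -> path neqn 0 v -> good 0 (v ++ [:: 0]) ->
  2 * asc_from 0 v <= m'.+1.
have Pm : P m.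
  move=> v sv v0 v1 pv gv; have [h hv hl] := min_letter v0.
  have h0 : 0 < h by apply: (allP v1).
  have [u [s [ev hu]]] := first_occ hv; subst v.
  move: hl; rewrite all_cat /= => /and3P[ul _ sl].
  have {}hu := all_leq_ltn ul hu.
  move: sv; rewrite size_cat /= => sv.
  (* If the word opens with its minimum, goodness forces it to close with it too; the initial ascent
     is then balanced by the final descent. *)
  have [u0|u0] := eqVneq u [::].
    subst u; move: pv => /= /andP[_ ps]; move: gv.
    rewrite good_cons_min // => /andP[/eqP ls gs].
    have [|_ /(_ h s erefl sl ps gs)] := IH (size s); first by move: sv => /=; lia.
    by rewrite ls eqxx h0 /= in sv *; lia.
  have [pu ps] : path neqn 0 u /\ path neqn h s.
    move: pv; rewrite !cat_path => /andP[pu /=] /andP[_ ps].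
    by rewrite pu ps.
  move: gv; rewrite -catA cat_cons good_cat //; last first.
    by apply: sub_all hu => x; apply: leq_ltn_trans.
  move=> /andP[gu gs].
  have u1 : all (leq 1) u by apply: sub_all hu => x; apply: leq_ltn_trans.
  have [|/(_ u erefl u0 u1 pu gu) Au _] := IH (size u); first by lia.
  have [|_ /(_ h s erefl sl ps gs) As] := IH (size s); first by lia.
  rewrite asc_from_cat /=.
  have -> : (last 0 u < h) = false.
    case: u u0 hu {ul gu pu u1 Au sv hv pv v1 v0} => [//|c u] _ /allP hu /=.
    by apply/negbTE; rewrite -leqNgt ltnW //; apply: hu; rewrite mem_last.
  by move: As; case: (last h s != h) => /=; lia.
split=> // h s ss sl ps gs.
(* Without a further h the word lies strictly above h, and the first bound applies with h in the
   role of the smaller letter 0. *)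
have [hs|hs] := boolP (h \in s); last first.
  have hl := all_leq_ltn sl hs.
  have [s0|s0] := eqVneq s [::]; first by subst s => /=; lia.
  rewrite (last_above s0 hl) asc_from_low //.
  have := Pm s ss s0; rewrite addn1; apply.
  - by apply: sub_all hl => x; apply: leq_ltn_trans.
  - by rewrite -(path_neq_low hl).
  case: s s0 hl gs {ss sl ps hs} => [//|c s] _ /= /andP[hc _].
  by rewrite hc (leq_ltn_trans _ hc).
have [u [s' [es hu]]] := first_occ hs; subst s.
move: sl ss; rewrite all_cat size_cat /= => /and3P[ul _ sl] ss.
have {}hu := all_leq_ltn ul hu.
have u0 : u != [::] by case: u ps {hs gs ul hu ss} => //=; rewrite eqxx.
move: ps; rewrite path_neq_cat // => /andP[pu ps].
move: gs; rewrite -catA cat_cons good_cat // => /andP[gu gs].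
have u1 : all (leq 1) u by apply: sub_all hu => x; apply: leq_ltn_trans.
have [|/(_ u erefl u0 u1 pu gu) Au _] := IH (size u); first by lia.
have [|_ /(_ h s' erefl sl ps gs) As] := IH (size s'); first by lia.
rewrite asc_from_cat last_cat /= asc_from_low //.
have -> : (last h u < h) = false.
  case: u u0 hu {ul gu pu u1 Au ss hs} => [//|c u] _ /allP hu /=.
  by apply/negbTE; rewrite -leqNgt ltnW //; apply: hu; rewrite mem_last.
by lia.
Qed.

(** * The gamma expansion *)

Section GammaExpansion.

Local Open Scope ring_scope.

Variable R : comNzRingType.

(* g = false: plain weight of a word with n steps and a ascents;
   g = true: weight of the hopping orbit represented by a good word. *)
Definition wt (g : bool) (n a : nat) (ok : bool) : {poly R} :=
  if g then if ok then 'X^a * (1 + 'X) ^+ (n - 2 * a) else 0 else 'X^a.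

(** The bounds exclude truncated subtraction, so the exponents of 1 + X add up. *)
Lemma wt_mul g n1 a1 (ok1 : bool) n2 a2 (ok2 : bool) :
  (ok1 -> 2 * a1 <= n1)%N -> (ok2 -> 2 * a2 <= n2)%N ->
  wt g n1 a1 ok1 * wt g n2 a2 ok2 = wt g (n1 + n2) (a1 + a2) (ok1 && ok2).
Proof.
rewrite /wt; case: g; last by rewrite exprD.
case: ok1 => /= [|_ _]; last by rewrite mul0r.
case: ok2 => /= [|_ _]; last by rewrite mulr0.
move=> /(_ isT) h1 /(_ isT) h2; rewrite mulrACA -!exprD.
by congr (_ * _ ^+ _); lia.
Qed.

(* Word over letters >= h between two letters smaller than h. *)
Definition wt_between g (v : seq nat) : {poly R} :=
  if (v != [::]) && path neqn 0 v
  then wt g (size v).+1 (asc_from 0 v) (good 0 (v ++ [:: 0%N])) else 0.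

(* Word over letters >= h after a letter h; b tells whether it stops above h,
   in which case the final step to a letter smaller than h is counted. *)
Definition wt_after g b h (s : seq nat) : {poly R} :=
  if path neqn h s && ((last h s != h) == b)
  then wt g (size s + b) (asc_from h s) (good h (s ++ [:: 0%N])) else 0.

Lemma asc_bound_between v : v != [::] -> all (leq 1) v -> path neqn 0 v ->
  good 0 (v ++ [:: 0%N]) -> (2 * asc_from 0 v <= (size v).+1)%N.
Proof. by move=> ? ? ? ?; apply: (good_asc_bound (size v)).1. Qed.

Lemma asc_bound_after h s : all (leq h) s -> path neqn h s ->
  good h (s ++ [:: 0%N]) -> (2 * asc_from h s <= size s + (last h s != h))%N.
Proof. by move=> ? ? ?; apply: (good_asc_bound (size s)).2. Qed.

Lemma all_ltn_pos h u : all (ltn h) u -> all (leq 1) u.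
Proof. by apply: sub_all => x; apply: leq_ltn_trans. Qed.

Lemma asc_from_peel h u s : u != [::] -> all (ltn h) u ->
  asc_from 0 (u ++ h :: s) = (asc_from 0 u + asc_from h s)%N.
Proof.
case: u => [//|c u] _ /allP hu; rewrite asc_from_cat /=.
have -> // : (last c u < h)%N = false.
by apply/negbTE; rewrite -leqNgt ltnW //; apply: hu; rewrite mem_last.
Qed.

(** Between two occurrences of h the word u is surrounded by smaller letters, so steps, ascents and
    goodness split at the first h. An empty u would repeat h, and both sides vanish. *)
Lemma wt_after_cat g b h u s : all (ltn h) u -> all (leq h) s ->
  wt_after g b h (u ++ h :: s) = wt_between g u * wt_after g b h s.
Proof.
move=> hu hs; rewrite /wt_after /wt_between.
have [->|u0] := eqVneq u [::]; first by rewrite /= eqxx mul0r.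
rewrite path_neq_cat // last_cat /= -catA cat_cons good_cat //.
have -> : asc_from h (u ++ h :: s) = (asc_from 0 u + asc_from h s)%N.
  rewrite -asc_from_peel //; case: u u0 hu => [//|c u] _ /= /andP[hc _].
  by rewrite hc (leq_ltn_trans _ hc).
have [pu|] := boolP (path neqn 0 u); last by rewrite mul0r.
have [ps|] := boolP (path neqn h s); last by rewrite mulr0.
have [<-|] /= := eqVneq (last h s != h) b; last by rewrite mulr0.
rewrite size_cat wt_mul; first by congr (wt _ _ _ _) => /=; lia.
- by apply: asc_bound_between => //; apply: all_ltn_pos hu.
- exact: asc_bound_after.
Qed.

Lemma wt_after_above g b h s : all (ltn h) s ->
  wt_after g b h s =
    if s == [::] then (~~ b)%:R else if b then wt_between g s else 0.
Proof.
move=> hs; rewrite /wt_after /wt_between.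
have [->|s0] := eqVneq s [::].
  rewrite /= eqxx; case: b => //=.
  by rewrite /wt /= expr0 mul1r expr0; case: g.
rewrite last_above // path_neq_low // asc_from_low //.
have -> : good h (s ++ [:: 0%N]) = good 0 (s ++ [:: 0%N]).
  case: s s0 hs => [//|c s] _ /= /andP[hc _].
  by rewrite hc (leq_ltn_trans _ hc).
by case: b; rewrite ?andbF //= andbT addn1.
Qed.

(** If s stops at h, [wt_after g false] omits the final descent below h. This extra step costs a
    factor 1 + X in an orbit weight and nothing in a plain weight. *)
Lemma wt_between_cat g h u s : (0 < h)%N -> u != [::] -> all (ltn h) u ->
  all (leq h) s ->
  wt_between g (u ++ h :: s) = wt_between g u *
    ((if g then 1 + 'X else 1) * wt_after g false h s + wt_after g true h s).
Proof.
move=> h0 u0 hu hs; rewrite /wt_after /wt_between.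
have -> : path neqn 0 (u ++ h :: s) = path neqn 0 u && path neqn h s.
  rewrite -path_neq_cat //; case: u u0 hu => [//|c u] _ /= /andP[hc _].
  by rewrite (ltn_eqF hc) (ltn_eqF (leq_ltn_trans _ hc)).
rewrite -catA cat_cons good_cat //; last exact: all_ltn_pos hu.
rewrite asc_from_peel // u0 /=.
have [pu|] := boolP (path neqn 0 u); last by rewrite /= andbF mul0r.
have [ps|] := boolP (path neqn h s); last by rewrite !(andbF, mulr0, addr0).
have Au := asc_bound_between u0 (all_ltn_pos hu) pu.
have As := asc_bound_after hs ps.
have -> : (u ++ h :: s != [::]) by case: (u).
rewrite size_cat; case: (last h s != h) As => /= As.
  rewrite mulr0 add0r wt_mul //.
  by congr (wt _ _ _ _); lia.
rewrite addr0.
have -> : (if g then 1 + 'X else 1) * wt g (size s + 0) (asc_from h s)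
    (good h (s ++ [:: 0%N])) =
    wt g (size s + 1) (asc_from h s) (good h (s ++ [:: 0%N])).
  rewrite /wt; case: g; last by rewrite mul1r.
  case: (good _ _) As => [/(_ isT) As|_]; last by rewrite mulr0.
  by rewrite mulrCA -exprS; congr (_ * _ ^+ _); lia.
rewrite wt_mul //; first by congr (wt _ _ _ _); lia.
by move=> /As; lia.
Qed.

(** The ascent into the leading h gives X. If the word ends at h, this ascent pairs with the final
    descent; otherwise the leading h is an unmatched double ascent, which a good word cannot
    have. *)
Lemma wt_between_cons g h s : (0 < h)%N -> all (leq h) s ->
  wt_between g (h :: s) =
    'X * wt_after g false h s + (if g then 0 else 'X) * wt_after g true h s.
Proof.
move=> h0 hs; rewrite /wt_after /wt_between cat_cons.
have -> : path neqn 0 (h :: s) = path neqn h s by rewrite /= (ltn_eqF h0).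
have -> : asc_from 0 (h :: s) = (1 + asc_from h s)%N by rewrite /= h0.
have [ps|] := boolP (path neqn h s); last by rewrite !mulr0 addr0.
rewrite good_cons_min //; have As := asc_bound_after hs ps.
case: eqVneq As => [ls|ls] /= As; last first.
  by rewrite mulr0 add0r /wt; case: g; rewrite ?mul0r // add1n exprS.
rewrite mulr0 addr0.
have -> : ('X : {poly R}) = wt g 2 1 true by rewrite /wt /= expr1 mulr1; case: g.
rewrite wt_mul //; first by congr (wt _ _ _ _); lia.
Qed.

Variable r : nat.

Definition sum_between g h L := \sum_(v <- words (iota h (r - h)) L) wt_between g v.

Definition sum_after g b h L := \sum_(s <- words (iota h (r - h)) L) wt_after g b h s.

Lemma words_geq h L v : v \in words (iota h (r - h)) L -> all (leq h) v.
Proof.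
by move/words_all; apply: sub_all => x; rewrite inE mem_iota => /andP[].
Qed.

Lemma iota_first h : (h < r)%N -> iota h (r - h) = h :: iota h.+1 (r - h.+1).
Proof.
by move=> hr; rewrite subnS; case: (r - h)%N (subn_gt0 h r) => [|m]; rewrite ?hr.
Qed.

Lemma sum_between0 g h : sum_between g h 0 = 0.
Proof. by rewrite /sum_between big_seq1. Qed.

(** The first term collects the words without h; the sum cuts the others at the first return to
    h. *)
Lemma sum_after_rec g b h L : (h < r)%N ->
  sum_after g b h L =
    (if L == 0%N then (~~ b)%:R else if b then sum_between g h.+1 L else 0) +
    \sum_(p < L) sum_between g h.+1 p * sum_after g b h (L - p).-1.
Proof.
move=> hr; rewrite {1}/sum_after iota_first // big_words_cons -iota_first //.
congr (_ + _).
  have [->|L0] := eqVneq L 0%N; first by rewrite big_seq1 wt_after_above.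
  transitivity (\sum_(v <- words (iota h.+1 (r - h.+1)) L)
      (if b then wt_between g v else 0)).
    rewrite big_seq_cond [RHS]big_seq_cond; apply: eq_bigr => v /andP[vL _].
    rewrite wt_after_above ?(words_geq vL) //.
    by have := size_words_mem vL; case: (v) => // s0; rewrite -s0 in L0.
  by case: b => //; rewrite big1.
apply: eq_bigr => p _; rewrite /sum_between /sum_after big_distrl /=.
rewrite big_seq_cond [RHS]big_seq_cond; apply: eq_bigr => u /andP[uL _].
rewrite big_distrr /= big_seq_cond [RHS]big_seq_cond; apply: eq_bigr => s /andP[sL _].
by rewrite wt_after_cat ?(words_geq uL) ?(words_geq sL).
Qed.

Lemma sum_between_rec g h L : (0 < h < r)%N ->
  sum_between g h L.+1 = sum_between g h.+1 L.+1 +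
    ('X * sum_after g false h L + (if g then 0 else 'X) * sum_after g true h L) +
    \sum_(p < L.+1) sum_between g h.+1 p *
      ((if g then 1 + 'X else 1) * sum_after g false h (L - p) +
       sum_after g true h (L - p)).
Proof.
move=> /andP[h0 hr]; rewrite {1}/sum_between iota_first // big_words_cons.
rewrite -iota_first // -addrA; congr (_ + _).
(* The term p = 0 is the case of words starting with h; its counterpart on the right vanishes by
   [sum_between0]. *)
rewrite [in LHS]big_ord_recl [in RHS]big_ord_recl /= sum_between0 mul0r add0r.
rewrite big_seq1 /sum_after; congr (_ + _).
  rewrite !big_distrr -big_split /= big_seq_cond [RHS]big_seq_cond.
  by apply: eq_bigr => s /andP[sL _]; rewrite wt_between_cons ?(words_geq sL).
apply: eq_bigr => p _; rewrite /bump leq0n add1n subSS -subnS.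
rewrite /sum_between big_distrl.
rewrite big_seq_cond [RHS]big_seq_cond; apply: eq_bigr => u /andP[uL _].
rewrite !big_distrr -big_split big_distrr /=.
rewrite big_seq_cond [RHS]big_seq_cond; apply: eq_bigr => s /andP[sL _].
have uh : all (ltn h) u := @words_geq h.+1 p.+1 u uL.
rewrite wt_between_cat ?(words_geq sL) //.
by have := @size_words_mem _ _ p.+1 _ uL; case: (u).
Qed.

(** Appending h to a word that ends above h trades the final step below h for a descent to h, with
    the same weight. The recursions reflect this bijection. *)
Lemma sum_after_shift g h L : (h < r)%N ->
  sum_after g true h L = sum_after g false h L.+1.
Proof.
move=> hr; elim/ltn_ind: L => L IH.
rewrite sum_after_rec // [RHS]sum_after_rec //= add0r big_ord_recr /= subSnn /=.
have -> : sum_after g false h 0 = 1.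
  by rewrite sum_after_rec // eqxx big_ord0 addr0.
rewrite mulr1 addrC; congr (_ + _).
  by case: eqP => // ->; rewrite sum_between0.
apply: eq_bigr => p _; rewrite IH; last by have := ltn_ord p; lia.
by congr (_ * sum_after _ _ _ _); have := ltn_ord p; lia.
Qed.

Lemma sum_after_eq h L : (h < r)%N ->
  (forall L, sum_between false h.+1 L = sum_between true h.+1 L) ->
  sum_after false false h L = sum_after true false h L.
Proof.
move=> hr eS; elim/ltn_ind: L => L IH.
rewrite !sum_after_rec //; congr (_ + _).
by apply: eq_bigr => p _; rewrite eS IH //; have := ltn_ord p; lia.
Qed.

(** Here g no longer occurs in the coefficients. By [sum_after_shift], convolving with
    [sum_after g false] yields [sum_after g true]; its total factor is 1 + X in both cases, as 1
    from the convolution plus X from a leading h for plain weights, and all from the convolution for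
    orbit weights. *)
Lemma sum_between_closed g h L : (0 < h < r)%N ->
  sum_between g h L.+1 = sum_between g h.+1 L.+1 + 'X * sum_after g false h L +
    (1 + 'X) * sum_after g true h L +
    \sum_(p < L.+1) sum_between g h.+1 p * sum_after g true h (L - p).
Proof.
move=> h0r; have /andP[_ hr] := h0r.
have conv c : \sum_(p < L.+1) sum_between g h.+1 p *
      (c * sum_after g false h (L - p) + sum_after g true h (L - p)) =
    c * sum_after g true h L +
    \sum_(p < L.+1) sum_between g h.+1 p * sum_after g true h (L - p).
  have -> : sum_after g true h L = \sum_(p < L.+1)
      sum_between g h.+1 p * sum_after g false h (L - p).
    rewrite sum_after_shift // sum_after_rec // add0r; apply: eq_bigr => p _.
    by rewrite subSn // -ltnS.
  rewrite mulr_sumr -big_split; apply: eq_bigr => p _ /=.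
  by rewrite mulrDr mulrCA.
rewrite sum_between_rec // conv !addrA; congr (_ + _); rewrite -!addrA.
by congr (_ + (_ + _)); case: g {conv}; rewrite ?mul0r ?add0r // mulrDl addrC.
Qed.

Lemma sum_between_eq h L : (0 < h)%N -> sum_between false h L = sum_between true h L.
Proof.
(* Induction on the number r - h of available letters: the recursion passes from h to the alphabet
   above h. *)
have [m mE] := ubnP (r - h); elim: m h mE L => // m IH h mE L h0.
case: L => [|L]; first by rewrite !sum_between0.
have [rh|hr] := leqP r h.
  have -> : sum_between false h L.+1 = 0.
    by rewrite /sum_between big_wordsS (eqP (rh : (r - h == 0)%N)) big_nil.
  by rewrite /sum_between big_wordsS (eqP (rh : (r - h == 0)%N)) big_nil.
have eS L' : sum_between false h.+1 L' = sum_between true h.+1 L'.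
  by apply: IH => //; lia.
have eE b L' : sum_after false b h L' = sum_after true b h L'.
  by case: b; rewrite ?sum_after_shift // sum_after_eq.
have h0r : (0 < h < r)%N by rewrite h0.
rewrite !(sum_between_closed _ _ h0r) eS !eE; congr (_ + _).
by apply: eq_bigr => p _; rewrite eS eE.
Qed.

(** With h = 0 and b = false the words are those of [SW] without their leading 0. *)
Lemma sum_after_gamma n : (0 < r)%N ->
  sum_after false false 0 n = sum_after true false 0 n.
Proof. by move=> r0; apply: sum_after_eq => // L; apply: sum_between_eq. Qed.

End GammaExpansion.

(** * The operator E_r and words *)

HB.instance Definition _ (R : realType) (r : nat) :=
  GRing.isLinear.Build R {poly R} {poly R} _ (@Eop R r) (@Eop_linear R r).

Section Eoperator.

Local Open Scope ring_scope.

Variables (R : realType) (r : nat).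
Hypothesis r_gt0 : (0 < r)%N.
Implicit Type p : {poly R}.

Lemma EopMXr p : Eop r ('X^r * p) = 'X * Eop r p.
Proof.
rewrite -[p]coefK poly_def mulr_sumr !linear_sum mulr_sumr; apply: eq_bigr => i _.
rewrite -scalerAr !linearZ /= -exprD !EopXn -scalerAr dvdn_addr // divnDl //.
by rewrite divnn r_gt0 add1n; case: ifP => _; rewrite ?mulr0 // exprS.
Qed.

Lemma EopXn_small m : (m < r)%N -> Eop r ('X^m : {poly R}) = (m == 0%N)%:R.
Proof.
move=> mr; rewrite EopXn; have [->|m0] := eqVneq m 0%N.
  by rewrite dvdn0 div0n expr0.
by rewrite gtnNdvd // lt0n.
Qed.

(** The exponents w + k with k < r meet each residue mod r once; those reaching r yield a factor X
    and restart below w. *)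
Lemma Eop_step_desc w p : (w < r)%N ->
  Eop r ('X^w * ((\sum_(0 <= k < r) 'X^k) * p)) =
  \sum_(w <= a < r) Eop r ('X^a * p) + 'X * \sum_(0 <= a < w) Eop r ('X^a * p).
Proof.
move=> wr; rewrite mulrA mulr_sumr mulr_suml linear_sum /=.
rewrite (@big_cat_nat _ _ _ (r - w)) ?leq_subr //=; congr (_ + _).
  rewrite -{3}[w]add0n big_addn; apply: eq_bigr => a _.
  by rewrite -exprD addnC.
rewrite -{1}[(r - w)%N]add0n big_addn subKn 1?ltnW // mulr_sumr.
apply: eq_bigr => a _; rewrite -EopMXr mulrA -!exprD; congr (Eop _ ('X^_ * _)); lia.
Qed.

(** A letter a is encoded by the exponent r - a. Adding k <= w leads down to the letter w - k;
    adding k > w passes r and leads up to r + w - k, with the factor X of an ascent. *)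
Lemma Eop_step_asc w p : (w < r)%N ->
  Eop r ('X^(r - w) * ((\sum_(1 <= k < r) 'X^k) * p)) =
  \sum_(0 <= a < w) Eop r ('X^(r - a) * p) +
    'X * \sum_(w.+1 <= a < r) Eop r ('X^(r - a) * p).
Proof.
move=> wr; rewrite mulrA mulr_sumr mulr_suml linear_sum /=.
rewrite (@big_cat_nat _ _ _ w.+1) //=; congr (_ + _).
  rewrite big_nat_rev big_add1 /=; apply: eq_big_nat => a aw.
  by rewrite -exprD; congr (Eop _ ('X^_ * _)); lia.
rewrite mulr_sumr big_nat_rev; apply: eq_big_nat => a aw.
rewrite -EopMXr mulrA -!exprD; congr (Eop _ ('X^_ * _)); lia.
Qed.

Definition asc_sum w n : {poly R} :=
  \sum_(s <- words (iota 0 r) n | path neqn w s && (last w s == 0%N)) 'X^(asc_from w s).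

Lemma asc_sumS w n : (w < r)%N ->
  asc_sum w n.+1 = \sum_(0 <= a < w) asc_sum a n + 'X * \sum_(w.+1 <= a < r) asc_sum a n.
Proof.
move=> wr; rewrite /asc_sum big_mkcond big_wordsS.
transitivity (\sum_(0 <= a < r) (if w == a then 0 else 'X^(w < a)%N * asc_sum a n)).
  rewrite /index_iota subn0; apply: eq_bigr => a _; rewrite /asc_sum /=.
  have [//|/= _] := eqVneq w a; first by rewrite big1.
  rewrite mulr_sumr [RHS]big_mkcond; apply: eq_bigr => s _.
  by case: ifP => // _; rewrite exprD.
rewrite (big_cat_nat (leq0n w) (ltnW wr)) /= [X in _ + X]big_ltn // eqxx add0r.
congr (_ + _); rewrite ?mulr_sumr; apply: eq_big_nat => a aw.
  have {}aw : (a < w)%N by case/andP: aw.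
  by rewrite gtn_eqF // ltnNge (ltnW aw) expr0 mul1r.
have {}aw : (w < a)%N by case/andP: aw.
by rewrite ltn_eqF // aw expr1.
Qed.

(** The two sums of [Eop_step_asc] are the descents and the ascents out of w. The letter 0 has
    exponent r rather than 0, hence the extra factor X. *)
Lemma Eop_asc_sum w n : (w < r)%N ->
  Eop r ('X^(r - w) * (\sum_(1 <= k < r) 'X^k) ^+ n) = 'X * asc_sum w n.
Proof.
elim: n w => [|n IH] w wr.
  rewrite expr0 mulr1 /asc_sum big_mkcond big_seq1 /=.
  have [->|w0] := eqVneq w 0%N; first
    by rewrite subn0 EopXn dvdnn divnn r_gt0 expr1 mulr1.
  rewrite mulr0 EopXn_small; last by move: w0; lia.
  by have -> : (r - w == 0)%N = false by lia.
rewrite exprS Eop_step_asc // asc_sumS // mulrDr; congr (_ + _).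
  by rewrite mulr_sumr; apply: eq_big_nat => a aw; apply: IH; lia.
by congr (_ * _); rewrite mulr_sumr; apply: eq_big_nat => a aw; apply: IH; lia.
Qed.

Lemma Eop_asc_sum0 n : Eop r ((\sum_(1 <= k < r) 'X^k) ^+ n) = asc_sum 0 n.
Proof.
have X0 : ('X : {poly R}) != 0 by rewrite polyX_eq0.
apply: (mulfI X0).
by rewrite -EopMXr -(Eop_asc_sum n r_gt0) subn0.
Qed.

End Eoperator.

(** * Words of [SW] as letter sequences, and goodness in terms of indices *)

Section Words.

Local Open Scope ring_scope.

Variables (n r : nat).
Implicit Type w : n.+1.-tuple 'I_r.

Lemma asc_from_sum c s :
  asc_from c s = (\sum_(i < size s) (nth 0 (c :: s) i < nth 0 s i))%N.
Proof.
elim: s c => [|d s IH] c /=; first by rewrite big_ord0.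
by rewrite big_ord_recl IH.
Qed.

Lemma big_SW (r_gt0 : (0 < r)%N) (M : nmodType) (F : seq nat -> M) :
  \sum_(w in SW n r) F [seq val x | x <- w] =
  \sum_(s <- words (iota 0 r) n | path neqn 0 s && (last 0 s == 0)%N) F (0%N :: s).
Proof.
pose P (l : seq nat) :=
  [&& head 0%N l == 0%N, path neqn 0 (behead l) & last 0%N (behead l) == 0%N].
transitivity (\sum_(w : n.+1.-tuple 'I_r | P [seq val x | x <- w])
    F [seq val x | x <- w]).
  apply: eq_bigl => w; rewrite inE /letter /P.
  have : size [seq val x | x <- w] = n.+1 by rewrite size_map size_tuple.
  case: [seq val x | x <- w] => [//|c s] [sn] /=.
  have [->|//] /= := eqVneq c 0%N; rewrite -sn (last_nth 0%N) andbC; congr (_ && _).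
  apply/forallP/(pathP 0%N) => [h i si|h i]; last exact: h.
  exact: (h (Ordinal si)).
rewrite big_mkcond (big_tuple_words n.+1 r (fun l => if P l then F l else 0)).
rewrite big_wordsS -(prednK r_gt0) big_cons addrC big1_seq ?add0r.
  by rewrite [RHS]big_mkcond; apply: eq_bigr.
move=> a /=; rewrite mem_iota => /andP[a0 _]; rewrite big1 // => s _.
by rewrite /P /= gtn_eqF.
Qed.

Lemma exitsP h p t :
  exits h p t <-> exists k, [/\ (k < size t)%N, (nth 0 t k < h)%N,
     nth 0%N (p :: t) k = h & forall m, (m < k)%N -> (h <= nth 0 t m)%N].
Proof.
elim: t p => [|c t IH] p /=; first by split=> // -[k []].
case: ltnP => ch.
  split=> [/eqP ->|[[|k] [_ _ /= e h0]]]; last 2 first.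
  - by rewrite e.
  - by have /= := h0 0%N isT; rewrite leqNgt ch.
  by exists 0%N.
rewrite IH; split=> [[k [kt tk e hm]]|[[|k] [kt tk e hm]]].
- by exists k.+1; split=> // -[|m] //= mk; apply: hm.
- by move: tk; rewrite /= ltnNge ch.
- by exists k; split=> // m mk; apply: (hm m.+1).
Qed.

Lemma goodP p t : good p t <-> forall j, (j < size t)%N ->
  (nth 0 (p :: t) j < nth 0 t j)%N -> (nth 0 t j < nth 0 t j.+1)%N ->
  exits (nth 0%N t j) (nth 0%N t j) (drop j.+1 t).
Proof.
elim: t p => [|c t IH] p /=; first by split.
split=> [/andP[h1 /IH h2] [|j] /=|h].
- by rewrite drop0 -nth0 in h1 * => _ pc ct; rewrite pc ct in h1.
- exact: h2.
apply/andP; split; last by apply/IH => j; apply: (h j.+1).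
by apply/implyP => /andP[pc ct]; have := h 0%N isT pc; rewrite /= drop0 nth0; apply.
Qed.

(** The first letter below w_j after a double ascent j must be preceded by w_j, and that preceding
    position is the matching double descent. The appended 0 creates no new double ascent, since w_n
    = 0 as well. *)
Lemma xi_word_good w s : [seq val x | x <- w] = 0%N :: s -> path neqn 0 s ->
  last 0%N s = 0%N -> xi_word w = good 0 (s ++ [:: 0%N]).
Proof.
move=> ew ps ls.
have sn : size s = n.
  by have := congr1 size ew; rewrite size_map size_tuple => -[].
pose f := nth 0%N (0%N :: s).
have fE i : letter w i = f i by rewrite /letter ew.
have tE i : nth 0%N (s ++ [:: 0%N]) i = f i.+1.
  rewrite nth_cat /f /=; case: ltnP => // h; rewrite [RHS]nth_default //.
  by case: (i - size s)%N => [|[|?]].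
have tE' i : nth 0%N (0%N :: s ++ [:: 0%N]) i = f i by case: i => [|i] //=.
have f0 i : (n <= i)%N -> f i = 0%N.
  rewrite leq_eqVlt => /orP[/eqP <-|ni]; last by rewrite /f nth_default //= sn.
  by rewrite -sn /f -(last_nth 0%N).
have fN i : (i < n)%N -> f i <> f i.+1.
  by move=> i_n; apply/eqP; move/(pathP 0%N): ps => /(_ i); rewrite sn; apply.
apply/idP/idP => [/forallP xw|/goodP gd].
  apply/goodP => j jn; rewrite tE' !tE => fj fj1.
  have jn1 : (j.+1 < n)%N.
    by rewrite ltnNge; apply/negP => nj; move: fj1; rewrite [f j.+2]f0 // ltnW.
  have := xw (Ordinal jn1); rewrite /double_ascent !fE /= fj fj1 /=.
  move=> /existsP[k /and4P[dk jk /eqP ek /forallP hk]].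
  move: dk; rewrite /double_descent !fE /= => /and3P[k0 _ dk].
  apply/exitsP; exists (k - j.+1)%N; rewrite size_drop size_cat sn addn1 /=.
  have kn := ltn_ord k; rewrite !fE /= in ek; split.
  - by lia.
  - by rewrite nth_drop tE ek (_ : (j.+1 + _)%N = k) //; lia.
  - have [e|] := posnP (k - j.+1); first by rewrite e.
    case E : (k - j.+1)%N => [//|i] _ /=; rewrite nth_drop tE ek; congr f; lia.
  move=> m mk; rewrite nth_drop tE.
  have [e|ne] := eqVneq (j.+1 + m).+1 k; first by rewrite e ek.
  have mn : ((j.+1 + m).+1 < n)%N by lia.
  have := hk (Ordinal mn); rewrite !fE /= => /implyP; apply; lia.
apply/forallP => j; apply/implyP; rewrite /double_ascent !fE => /and3P[j0 fj fj1].
have jE : j = j.-1.+1 :> nat by rewrite prednK.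
have jn := ltn_ord j.
(* Positions in [good] refer to s, which lacks the leading letter of w. *)
have := gd j.-1; rewrite size_cat sn /= tE' !tE -jE => /(_ _ fj fj1).
move=> /(_ ltac:(lia))/exitsP[k []].
rewrite size_drop size_cat sn nth_drop tE /= => kn fk ek hk.
have k0 : (0 < k)%N.
  by case: (k) fk => //; rewrite addn0; lia.
have {}ek : f (j + k)%N = f j.
  by case: (k) k0 ek => //= i _; rewrite nth_drop tE => <-; congr f; lia.
have jkn : (j + k < n)%N.
  rewrite ltnNge; apply/negP => njk; move: ek; rewrite f0 // => ek.
  by rewrite -ek in fj.
have {}hk m : (m < k)%N -> (f j <= f (j + m).+1)%N.
  by move=> mk; have := hk m mk; rewrite nth_drop tE.
apply/existsP; exists (Ordinal jkn); rewrite !fE /= ek eqxx /double_descent !fE /= ek.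
(* The letter before position j + k is at least w_j and differs from its successor, which equals
   w_j. *)
have -> : (f j < f (j + k).-1)%N.
  have jk1 : (j + k).-1.+1 = (j + k)%N by lia.
  have ne : f (j + k).-1 <> f (j + k)%N by rewrite -{2}jk1; apply: fN; lia.
  rewrite ltn_neqAle; apply/andP; split; first by apply/eqP => e; apply: ne; rewrite ek.
  have [k1|k1] := eqVneq k 1%N; first by rewrite k1 addn1.
  have -> : (j + k).-1 = (j + k.-2).+1 by lia.
  by apply: hk; lia.
have -> : (0 < j + k)%N by lia.
have -> : (j < j + k)%N by lia.
rewrite fk /=; apply/forallP => m; apply/implyP => /andP[jm mk]; rewrite !fE.
have -> : m = (j + (m - j.+1)).+1 :> nat by lia.
by apply: hk; lia.
Qed.

End Words.

(** * The sums over [SW] as generating functions of letter sequences *)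

Section Gamma.

Local Open Scope ring_scope.

Variables (R : realType) (n r : nat).
Hypothesis r_gt0 : (0 < r)%N.
Implicit Type w : n.+1.-tuple 'I_r.

Lemma asc_letters w s : [seq val x | x <- w] = 0%N :: s -> asc w = asc_from 0 s.
Proof.
move=> ew; have sn : size s = n.
  by have := congr1 size ew; rewrite size_map size_tuple => -[].
rewrite asc_from_sum sn /asc -sum1_card big_mkcond /=.
by apply: eq_bigr => i _; rewrite inE /letter ew; case: ltnP.
Qed.

Lemma SW_letters w : w \in SW n r -> exists s,
  [/\ [seq val x | x <- w] = 0%N :: s, path neqn 0 s, last 0%N s = 0%N & size s = n].
Proof.
rewrite inE /letter.
have : size [seq val x | x <- w] = n.+1 by rewrite size_map size_tuple.
case: [seq val x | x <- w] => [//|c s] [sn] /and3P[/eqP /= -> ls ps].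
exists s; split=> //; last by rewrite (last_nth 0%N) sn; apply/eqP.
apply/(pathP 0%N) => i si; rewrite sn in si.
by have /forallP/(_ (Ordinal si)) := ps.
Qed.

Lemma sum_SW_asc : \sum_(w in SW n r) 'X^(asc w) = asc_sum R r 0 n.
Proof.
apply: etrans (@big_SW n r r_gt0 _ (fun l => 'X^(asc_from 0 (behead l)))).
apply: eq_bigr => w /SW_letters[s [ew _ _ _]].
by rewrite ew (asc_letters ew).
Qed.

Lemma asc_sum_after : asc_sum R r 0 n = sum_after R r false false 0 n.
Proof.
rewrite /asc_sum /sum_after subn0 big_mkcond; apply: eq_bigr => s _.
by rewrite /wt_after eqbF_neg negbK.
Qed.

Lemma sum_xi :
  \sum_(i < n./2.+1) (xi n r i)%:R *: ('X^i * (1 + 'X) ^+ (n - 2 * i)) =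
  sum_after R r true false 0 n.
Proof.
pose Q i : {poly R} := 'X^i * (1 + 'X) ^+ (n - 2 * i).
transitivity (\sum_(w in SW n r) if xi_word w then Q (asc w) else 0); last first.
  transitivity (\sum_(w in SW n r) let s := behead [seq val x | x <- w] in
      if good 0 (s ++ [:: 0%N]) then Q (asc_from 0 s) else 0).
    apply: eq_bigr => w /SW_letters[s [ew ps ls _]].
    by rewrite ew (xi_word_good ew) // (asc_letters ew).
  rewrite (@big_SW n r r_gt0 _ (fun l => let s := behead l in
    if good 0 (s ++ [:: 0%N]) then Q (asc_from 0 s) else 0)) /=.
  rewrite /sum_after subn0 big_mkcond big_seq_cond [RHS]big_seq_cond.
  apply: eq_bigr => s /andP[sw _].
  by rewrite /wt_after eqbF_neg negbK (size_words_mem sw) addn0.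
transitivity (\sum_(w in SW n r) \sum_(i < n./2.+1)
    if (asc w == i) && xi_word w then Q i else 0).
  rewrite exchange_big; apply: eq_bigr => i _.
  rewrite /xi -sum1_card natr_sum scaler_suml big_mkcond [RHS]big_mkcond.
  by apply: eq_bigr => w _; rewrite inE scale1r; case: (w \in SW n r).
apply: eq_bigr => w /SW_letters[s [ew ps ls sn]].
rewrite (asc_letters ew); case: ifP => xw; last by rewrite big1 // => i; rewrite andbF.
(* The ascent bound ensures that each good word is counted by exactly one i in the range. *)
have bd : (asc_from 0 s < n./2.+1)%N.
  have s0 : all (leq 0) s by apply/allP.
  have gs : good 0 (s ++ [:: 0%N]) by rewrite -(xi_word_good ew).
  by have := asc_bound_after s0 ps gs; rewrite ls sn /=; lia.
rewrite (bigD1 (Ordinal bd)) //= eqxx big1 ?addr0 // => i.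
by rewrite -val_eqE /= eq_sym => /negbTE ->.
Qed.

End Gamma.

(** * Faces of the edgewise subdivision as chains *)

Section PrefixSums.

Variables n r : nat.
Implicit Types (a b : Vr n r) (E : {set Vr n r}).

(** Shifted by one against [iota_vec], so that both the initial value 0 and the final value r are
    available. *)
Definition pre a (i : nat) : nat := \sum_(j < n | j < i) val a j.

Lemma pre0 a : pre a 0 = 0.
Proof. by rewrite /pre big_pred0. Qed.

Lemma pre_full a : pre a n = r.
Proof. by rewrite -[RHS](eqP (valP a)); apply: eq_bigl => i; rewrite ltn_ord. Qed.

Lemma preS a (i : 'I_n) : pre a i.+1 = pre a i + val a i.
Proof.
rewrite /pre (bigD1 i) //= addnC; congr (_ + _); apply: eq_bigl => j.
by rewrite ltnS ltn_neqAle -val_eqE andbC.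
Qed.

Lemma pre_leq a i : pre a i <= r.
Proof.
rewrite -(pre_full a) /pre big_mkcond [leqRHS]big_mkcond leq_sum // => j _.
by rewrite ltn_ord; case: ifP.
Qed.

Lemma pre_inj a b : (forall i, i <= n -> pre a i = pre b i) -> a = b.
Proof.
move=> e; apply/val_inj/ffunP => i; apply/val_inj/eqP => /=.
by rewrite -(eqn_add2l (pre a i)) -preS (e i (ltnW (ltn_ord i))) -preS e.
Qed.

Lemma iota_vecE a (i : 'I_n) : iota_vec a i = Posz (pre a i.+1).
Proof. by rewrite /iota_vec /pre (big_morph Posz PoszD erefl). Qed.

Lemma diff01P a b : reflect
  (forall i, i <= n -> pre b i <= pre a i <= (pre b i).+1) (diff01 a b).
Proof.
apply: (iffP forallP) => [h [|i] i_n|h i]; first by rewrite !pre0.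
  have := h (Ordinal i_n); rewrite !iota_vecE !inE /=; lia.
have := h i.+1 (ltn_ord i); rewrite !iota_vecE !inE; lia.
Qed.

Lemma vec_of_pre (g : nat -> nat) : (forall i, i < n -> g i <= g i.+1) ->
  g 0 = 0 -> g n = r -> exists b : Vr n r, forall i, i <= n -> pre b i = g i.
Proof.
move=> gS g0 gn.
have gmono i j : i <= j -> j <= n -> g i <= g j.
  elim: j => [|j IH]; first by rewrite leqn0 => /eqP ->.
  rewrite leq_eqVlt => /orP[/eqP -> //|ij] jn.
  exact: leq_trans (IH ij (ltnW jn)) (gS j jn).
pose a : {ffun 'I_n -> 'I_r.+1} := [ffun i : 'I_n => inord (g i.+1 - g i)].
have aE (i : 'I_n) : a i = g i.+1 - g i :> nat.
  rewrite ffunE inordK // ltnS -gn (leq_trans (leq_subr _ _)) // gmono //.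
have sumE i : i <= n -> \sum_(j < n | j < i) a j = g i.
  elim: i => [|i IH] i_n; first by rewrite big_pred0.
  rewrite (bigD1 (Ordinal i_n)) //= aE.
  rewrite (eq_bigl (fun j : 'I_n => j < i)) => [|j]; last first.
    by rewrite ltnS [RHS]ltn_neqAle -val_eqE andbC.
  by rewrite (IH (ltnW i_n)) addnC subnKC // gS.
have ar : \sum_i a i == r.
  apply/eqP; transitivity (g n) => //; rewrite -(sumE n) //.
  by apply: eq_bigl => i; rewrite ltn_ord.
by exists (exist _ a ar).
Qed.

Lemma divn_eq_between m d q : 0 < d -> q * d <= m < q.+1 * d -> m %/ d = q.
Proof.
by move=> d0 /andP[h1 h2]; apply/eqP; rewrite eqn_leq -ltnS ltn_divLR // h2 leq_divRL.
Qed.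

(** The position of b in the chain E, counted from 0 at the bottom. *)
Definition rank E b := \sum_(a in E) ((a != b) && diff01 b a).

Lemma rank_lt E b : b \in E -> rank E b < #|E|.
Proof.
move=> bE; rewrite /rank -sum1_card (bigD1 b) //= [ltnRHS](bigD1 b) //= eqxx.
by rewrite add0n add1n ltnS leq_sum // => a _; case: (_ && _).
Qed.

Lemma edgewiseP E a b : E \in edgewise n r -> a \in E -> b \in E ->
  diff01 a b || diff01 b a.
Proof.
rewrite inE => /forallP/(_ a)/implyP h aE.
by move: (h aE) => /forallP/(_ b)/implyP.
Qed.

(* In the chain E, the vertices below b fall short of the i-th prefix sum of b
   by at most 1, and those above b exceed it by at most 1. *)
Lemma pre_rank E b i : E \in edgewise n r -> b \in E -> i <= n ->
  pre b i = (\sum_(a in E) pre a i + rank E b) %/ #|E|.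
Proof.
move=> Eedge bE i_n; have E0 : 0 < #|E| by apply/card_gt0P; exists b.
apply/esym/divn_eq_between => //; rewrite /rank -big_split /=.
have bd a : a \in E ->
    pre b i <= pre a i + ((a != b) && diff01 b a) <= (pre b i).+1.
  move=> aE; case: eqVneq => [->|_] /=; first by rewrite addn0 leqnn leqnSn.
  have := edgewiseP Eedge aE bE; case: (boolP (diff01 b a)) => /=.
    by move=> /diff01P/(_ i i_n) h _; rewrite addn1; lia.
  by rewrite orbF addn0 => _ /diff01P/(_ i i_n).
apply/andP; split.
  by rewrite mulnC -sum_nat_const leq_sum // => a /bd/andP[].
rewrite mulnC -sum_nat_const (bigD1 b) //= [ltnRHS](bigD1 b) //= eqxx addn0.
by rewrite -addSn leq_add // leq_sum // => a /andP[/bd/andP[]].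
Qed.

Lemma rank_inj E : E \in edgewise n r -> {in E &, injective (rank E)}.
Proof.
move=> Eedge a b aE bE e; apply: pre_inj => i i_n.
by rewrite (pre_rank Eedge aE i_n) (pre_rank Eedge bE i_n) e.
Qed.

Lemma rank_onto E j : E \in edgewise n r -> j < #|E| ->
  exists2 b, b \in E & rank E b = j.
Proof.
move=> Eedge jE; have E0 := leq_ltn_trans (leq0n j) jE.
pose f b : 'I_#|E| := insubd (Ordinal E0) (rank E b).
have fE b : b \in E -> f b = rank E b :> nat.
  by move=> bE; rewrite val_insubd rank_lt.
have : Ordinal jE \in f @: E.
  suff -> : f @: E = setT by rewrite inE.
  apply/eqP; rewrite eqEcard subsetT /= cardsT card_ord card_in_imset //.
  by move=> a b aE bE /(congr1 val) /=; rewrite !fE //; apply: rank_inj.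
by case/imsetP => b bE /(congr1 val) /=; rewrite fE // => ->; exists b.
Qed.

(* The j-th vertex of the chain has i-th prefix sum (g i + j) %/ k, so that the
   vertices of the chain add up to the vector with prefix sums g. *)
Definition chain_of (k : nat) (g : nat -> nat) : {set Vr n r} :=
  [set b | [exists j : 'I_k, [forall i : 'I_n.+1, pre b i == (g i + j) %/ k]]].

Lemma chain_ofP k g b : reflect
  (exists2 j, j < k & forall i, i <= n -> pre b i = (g i + j) %/ k)
  (b \in chain_of k g).
Proof.
rewrite inE; apply: (iffP existsP) => [[j /forallP h]|[j jk h]].
  by exists j => // i i_n; apply/eqP/(h (Ordinal (i_n : i < n.+1))).
by exists (Ordinal jk); apply/forallP => i; rewrite h //= -ltnS.
Qed.

Lemma chain_of_face E k : E \in edgewise n r -> #|E| = k -> 0 < k ->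
  chain_of k (fun i => \sum_(a in E) pre a i) = E.
Proof.
move=> Eedge <- E0; apply/setP => b; apply/chain_ofP/idP => [[j jE h]|bE].
  have [b' b'E e] := rank_onto Eedge jE.
  suff -> : b = b' by [].
  by apply: pre_inj => i i_n; rewrite h // (pre_rank Eedge b'E i_n) e.
by exists (rank E b) => [|i i_n]; [apply: rank_lt | apply: pre_rank].
Qed.

(** The vertices of ranks k - beta and k - beta - 1 are distinct, so some prefix sum tells them
    apart; by [pre_rank] the quotient jumps between these ranks only at residue beta. Residue 0
    occurs at i = 0. *)
Lemma face_residues E k beta : E \in edgewise n r -> #|E| = k -> beta < k ->
  exists2 i, i <= n & (\sum_(a in E) pre a i) %% k = beta.
Proof.
move=> Eedge Ek bk; have k0 := leq_ltn_trans (leq0n beta) bk.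
have [->|b0] := posnP beta.
  by exists 0 => //; rewrite big1 ?mod0n // => a _; rewrite pre0.
have jk : k - beta < #|E| by lia.
have [b bE rb] := rank_onto Eedge jk.
have [c cE rc] := rank_onto Eedge (leq_ltn_trans (leq_pred _) jk).
have /existsP[i ni] : [exists i : 'I_n.+1, pre b i != pre c i].
  apply: contraT; rewrite negb_exists => /forallP eqi.
  suff bc : b = c by move: rb rc; rewrite bc; lia.
  apply: pre_inj => i i_n; apply/eqP; have := eqi (Ordinal (i_n : i < n.+1)).
  by rewrite negbK.
have i_n : i <= n by rewrite -ltnS.
exists i => //; move: ni; rewrite (pre_rank Eedge bE i_n) (pre_rank Eedge cE i_n).
rewrite rb rc Ek.
set g := \sum_(a in E) _ => ni.
have := divn_eq g k; have := ltn_pmod g k0; move: (g %/ k) (g %% k) => q m mk e.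
apply: contraNeq ni => /eqP nm; apply/eqP.
have [lt|ge] := ltnP (m + (k - beta)) k.
  by rewrite !(@divn_eq_between _ k q) //; apply/andP; split; lia.
by rewrite !(@divn_eq_between _ k q.+1) //; apply/andP; split; lia.
Qed.

(** Hermite's identity: raising g by one replaces the term g %/ k by (g + k) %/ k, which is larger
    by one. *)
Lemma sum_div_shift k g : 0 < k -> \sum_(j < k) (g + j) %/ k = g.
Proof.
move=> k0; elim: g => [|g IH].
  by rewrite big1 // => j _; rewrite add0n divn_small.
rewrite -{2}IH -(big_mkord xpredT (fun j => (g.+1 + j) %/ k)).
rewrite -(big_mkord xpredT (fun j => (g + j) %/ k)).
have -> : \sum_(0 <= j < k) (g.+1 + j) %/ k = \sum_(1 <= j < k.+1) (g + j) %/ k.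
  by rewrite big_add1; apply: eq_bigr => j _; rewrite addSnnS.
have := @big_nat_recr _ _ addn k 0 (fun j => (g + j) %/ k) isT.
rewrite big_nat_recl // addn0 divnDr ?dvdnn // divnn k0.
rewrite big_add1 /=; lia.
Qed.

Section ChainOf.

Variables (k : nat) (g : nat -> nat).
Hypotheses (k_gt0 : 0 < k) (gS : forall i, i < n -> g i <= g i.+1)
  (g0 : g 0 = 0) (gn : g n = r * k)
  (gres : forall beta, beta < k -> exists2 i, i <= n & g i %% k = beta).

Lemma chain_of_vertices : exists f : 'I_k -> Vr n r,
  [/\ forall j i, i <= n -> pre (f j) i = (g i + j) %/ k, injective f
    & chain_of k g = [set f j | j : 'I_k]].
Proof.
have /fin_all_exists[f fE] (j : 'I_k) : exists b : Vr n r,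
    forall i, i <= n -> pre b i = (g i + j) %/ k.
  apply: (@vec_of_pre (fun i => (g i + j) %/ k)).
  - by move=> i i_n; rewrite leq_div2r // leq_add2r gS.
  - by rewrite g0 add0n divn_small.
  - by rewrite gn divnMDl // divn_small // addn0.
exists f; split=> //; last first.
  apply/setP => b; apply/chain_ofP/imsetP => [[j jk h]|[j _ ->]].
    exists (Ordinal jk) => //; apply: pre_inj => i i_n.
    by rewrite fE // h.
  by exists j => // i; apply: fE.
have main (j j' : 'I_k) : j < j' -> f j <> f j'.
  move=> jj' e; have j'k := ltn_ord j'.
  (* At residue k - j' the j'-th quotient has just jumped, while that of the smaller j has not. *)
  have [|i i_n gi] := gres (beta := k - j'); first by lia.
  have := fE j i i_n; rewrite e fE // {1 2}(divn_eq (g i) k) gi.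
  move: (g i %/ k) => q.
  rewrite (@divn_eq_between _ k q.+1) //; last by apply/andP; split; lia.
  by rewrite (@divn_eq_between _ k q) //; [lia | apply/andP; split; lia].
move=> j j' e; apply/val_inj.
by case: (ltngtP j j') => // /main; rewrite e.
Qed.

Lemma card_chain_of : #|chain_of k g| = k.
Proof.
by have [f [_ finj ->]] := chain_of_vertices; rewrite card_imset // card_ord.
Qed.

Lemma chain_of_edgewise : chain_of k g \in edgewise n r.
Proof.
rewrite inE; apply/forallP => a; apply/implyP => /chain_ofP[j jk aE].
apply/forallP => b; apply/implyP => /chain_ofP[j' j'k bE].
wlog jj' : a b j j' jk j'k aE bE / j <= j'.
  move=> H; have [jj'|/ltnW jj'] := leqP j j'; first exact: (H a b j j').
  by rewrite orbC; apply: (H b a j' j).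
apply/orP; right; apply/diff01P => i i_n; rewrite aE // bE //.
rewrite leq_div2r ?leq_add2l //=.
have := @leq_div2r k (g i + j') (g i + j + k) ltac:(lia).
by rewrite (divnDr (g i + j) (dvdnn k)) divnn k_gt0 addn1.
Qed.

Lemma sum_chain_of i : i <= n -> \sum_(b in chain_of k g) pre b i = g i.
Proof.
move=> i_n; have [f [fE finj ->]] := chain_of_vertices.
rewrite big_imset /=; last by move=> ? ? _ _; apply: finj.
rewrite -[RHS](sum_div_shift (g i) k_gt0).
by apply: eq_bigr => j _; rewrite fE.
Qed.

End ChainOf.

(** An entry vanishes exactly where the prefix sums stay constant. *)
Lemma carrier_subset E (F : {set 'I_n}) : (edgewise_carrier E \subset F) =
  [forall b in E, forall i : 'I_n, (i \notin F) ==> (pre b i.+1 == pre b i)].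
Proof.
apply/bigcupsP/forallP => [h b|h b bE].
  apply/implyP => bE; apply/forallP => i; apply/implyP => iF.
  rewrite preS -{2}[pre b i]addn0 eqn_add2l.
  by apply: contraNT iF => bi; apply: (subsetP (h b bE)); rewrite inE.
apply/subsetP => i; rewrite inE; apply: contraNT => iF.
have := h b; rewrite bE => /forallP/(_ i)/implyP/(_ iF).
by rewrite preS -{2}[pre b i]addn0 eqn_add2l.
Qed.

End PrefixSums.

(** * Counting sequences of prefix sums *)

Lemma sum_wordsS (T : Type) (A : seq T) L (F : seq T -> nat) :
  \sum_(v <- words A L.+1) F v = \sum_(a <- A) \sum_(v <- words A L) F (a :: v).
Proof. exact: big_wordsS. Qed.

(* The word c :: s is weakly increasing, and stays constant at the steps not
   selected by the mask. *)
Fixpoint mask_path (m : bitseq) (c : nat) (s : seq nat) : bool :=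
  match m, s with
  | b :: m', d :: s' => (if b then c <= d else d == c) && mask_path m' d s'
  | _, _ => true
  end.

Lemma mask_pathP m c s : size m = size s -> reflect
  (forall i, i < size s -> if nth false m i then nth 0 (c :: s) i <= nth 0 s i
                           else nth 0 s i == nth 0 (c :: s) i)
  (mask_path m c s).
Proof.
elim: m c s => [|b m IH] c [|d s] //=; first by move=> _; apply: ReflectT.
move=> [sz]; apply: (iffP andP) => [[h /(IH d s sz) hs] [|i] //= i_s|h]; first exact: hs.
split; first exact: (h 0).
by apply/(IH d s sz) => i; apply: (h i.+1).
Qed.

Lemma mask_path_mem m c s : size m = size s -> mask_path m c s ->
  c :: s =i c :: mask m s.
Proof.
elim: m c s => [|b m IH] c [|d s] //= [sz] /andP[h hs] x.
case: b h => /= [_|/eqP dc].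
  by rewrite inE (IH d s sz hs x) !inE.
by have := IH d s sz hs x; rewrite dc !inE => <-; rewrite orbA orbb.
Qed.

(** Entries at unselected positions are forced to repeat their predecessor, so only the masked
    subsequence is free. *)
Lemma sum_mask_path (A : seq nat) m c (Q : seq nat -> nat) : uniq A -> c \in A ->
  \sum_(s <- words A (size m)) mask_path m c s * Q (mask m s) =
  \sum_(s <- words A (count id m)) path leq c s * Q s.
Proof.
move=> uA; elim: m c Q => [|[] m IH] c Q cA; first by rewrite !big_seq1.
  have -> : count id (true :: m) = (count id m).+1 by [].
  rewrite (sum_wordsS _ (size m)) sum_wordsS.
  rewrite big_seq_cond [RHS]big_seq_cond; apply: eq_bigr => a /andP[aA _].
  have := IH a (fun s => Q (a :: s)) aA => /= IHa.
  transitivity ((c <= a) * \sum_(s <- words A (size m))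
      mask_path m a s * Q (a :: mask m s)).
    by rewrite big_distrr; apply: eq_bigr => s _; rewrite /= mulnA mulnb.
  rewrite IHa big_distrr.
  by apply: eq_bigr => s _; rewrite /= mulnA mulnb.
have -> : count id (false :: m) = count id m by [].
rewrite (sum_wordsS _ (size m)) (bigD1_seq c) //= [X in _ + X]big1 ?addn0.
  by rewrite -IH //; apply: eq_bigr => s _; rewrite eqxx.
by move=> a /negbTE ac; rewrite big1 // => s _; rewrite ac.
Qed.

(** The conditions met by the summed prefix sums of a chain of k vertices: the total [r * k] and
    every residue mod k occur. *)
Definition covers k r (s : seq nat) : bool :=
  (r * k \in s) && all (fun beta => has (fun x => x %% k == beta) s) (iota 0 k).

Lemma covers_mem k r s1 s2 : s1 =i s2 -> covers k r s1 = covers k r s2.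
Proof.
move=> e; rewrite /covers e; congr (_ && _).
by apply: eq_all => beta; apply: eq_has_r.
Qed.

(** Block beta consists of the r values from [beta * r] on; among values up to [r * k], block k is
    [r * k] alone. *)
Definition hits_blocks k r (s : seq nat) : bool :=
  all (fun beta => has (fun x => x %/ r == beta) s) (iota 0 k.+1).

Lemma hits_blocks_mem k r s1 s2 : s1 =i s2 -> hits_blocks k r s1 = hits_blocks k r s2.
Proof. by move=> e; apply: eq_all => beta; apply: eq_has_r. Qed.

(* Transposition of the index x = (x %/ k) * k + x %% k of an r x k array. *)
Definition transp k r x := if x < r * k then x %% k * r + x %/ k else x.

Section Transpose.

Variables k r : nat.
Hypotheses (k_gt0 : 0 < k) (r_gt0 : 0 < r).

Lemma transp_lt x : x < r * k -> transp k r x < r * k.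
Proof.
move=> xrk; rewrite /transp xrk; have := ltn_pmod x k_gt0.
have : x %/ k < r by rewrite ltn_divLR.
by move: (x %% k) (x %/ k) => m q; nia.
Qed.

Lemma transp_leq x : x <= r * k -> transp k r x <= r * k.
Proof.
rewrite leq_eqVlt => /orP[/eqP ->|/transp_lt/ltnW //].
by rewrite /transp ltnn.
Qed.

Lemma transp_div x : x < r * k -> transp k r x %/ r = x %% k.
Proof.
by move=> xrk; rewrite /transp xrk divnMDl // divn_small ?addn0 // ltn_divLR.
Qed.

(** Below [r * k] transposition turns the residue mod k into the block number; it fixes [r * k], the
    only value in block k. *)
Lemma covers_transp s : all (geq (r * k)) s -> 0 \in s ->
  covers k r s = hits_blocks k r (map (transp k r) s).
Proof.
move=> /allP srk s0; rewrite /covers /hits_blocks -[k.+1]addn1 iotaD add0n all_cat /=.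
rewrite andbT andbC; congr (_ && _).
  apply: eq_in_all => beta; rewrite mem_iota add0n => /= bk.
  rewrite has_map; apply/hasP/hasP => -[x xs /= /eqP e].
    have := srk x xs; rewrite /= leq_eqVlt => /orP[/eqP xe|xrk].
      (* The value [r * k] has residue 0 but stays in block k; the letter 0 takes its place in block
         0. *)
      exists 0 => //=; rewrite transp_div ?muln_gt0 ?r_gt0 // mod0n -e xe modnMl //.
    by exists x => //=; rewrite transp_div // e.
  have := srk x xs; rewrite /= leq_eqVlt => /orP[/eqP xe|xrk].
    by move: e; rewrite xe /transp ltnn mulKn // => e; move: bk; rewrite e ltnn.
  by exists x => //; rewrite -transp_div // e.
rewrite has_map; apply/idP/hasP => [rks|[x xs /= /eqP e]].
  by exists (r * k) => //=; rewrite /transp ltnn mulKn.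
have := srk x xs; rewrite /= leq_eqVlt => /orP[/eqP <- //|xrk].
by have := ltn_pmod x k_gt0; rewrite -transp_div // e ltnn.
Qed.

End Transpose.

Lemma transpK k r x : 0 < k -> 0 < r -> x <= r * k ->
  transp r k (transp k r x) = x.
Proof.
move=> k0 r0; rewrite leq_eqVlt => /orP[/eqP ->|xrk].
  by rewrite /transp ltnn mulnC ltnn.
have lt := transp_lt k0 r0 xrk; rewrite {1}/transp mulnC lt transp_div //.
rewrite {1}/transp xrk modnMDl modn_small ?ltn_divLR //.
by rewrite -divn_eq.
Qed.

Lemma sum_bool_count (T : Type) (P : pred T) (W : seq T) :
  \sum_(s <- W) (P s : nat) = count P W.
Proof. by rewrite -sum1_count [RHS]big_mkcond; apply: eq_bigr => s _; case: (P s). Qed.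

Lemma path_leq0 s : path leq 0 s = sorted leq s.
Proof. by rewrite (path_sortedE leq_trans); apply/andb_idl => _; apply/allP. Qed.

Lemma words_iota0P M d s : reflect (size s = d /\ forall x, x \in s -> x < M)
  (s \in words (iota 0 M) d).
Proof.
rewrite mem_words; apply: (iffP andP) => -[/eqP sd h]; split=> //.
  by move=> x /(allP h); rewrite inE mem_iota.
by apply/allP => x /h; rewrite inE mem_iota.
Qed.

(* A multiset can be listed in increasing order before or after transposition. *)
Lemma sum_covers_blocks k r d : 0 < k -> 0 < r ->
  \sum_(s <- words (iota 0 (r * k).+1) d) (path leq 0 s && covers k r (0 :: s)) =
  \sum_(s <- words (iota 0 (r * k).+1) d) (path leq 0 s && hits_blocks k r (0 :: s)).
Proof.
move=> k0 r0; set W := words _ d.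
rewrite !sum_bool_count -!size_filter.
pose f s := sort leq (map (transp k r) s).
rewrite -(size_map f); apply: perm_size.
have tr0 : transp k r 0 = 0.
  by rewrite /transp; case: ifP => // _; rewrite mod0n div0n.
have WP s : reflect (size s = d /\ forall x, x \in s -> x <= r * k) (s \in W).
  by apply: (iffP (words_iota0P _ _ _)).
have covE s : s \in W -> covers k r (0 :: s) = hits_blocks k r (0 :: f s).
  move=> /WP[_ sW]; rewrite covers_transp ?mem_head //=; last by apply/allP => x /sW.
  rewrite tr0; apply: hits_blocks_mem => x; rewrite !inE; congr (_ || _).
  by rewrite mem_sort.
have fW s : s \in W -> f s \in W.
  move=> /WP[sd sW]; apply/WP; rewrite size_sort size_map; split=> // x.
  by rewrite mem_sort => /mapP[y /sW ys ->]; apply: transp_leq.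
have uW : uniq W by rewrite words_uniq ?iota_uniq.
have trK s : s \in W -> map (transp r k) (map (transp k r) s) = s.
  move=> /WP[_ sW]; rewrite -map_comp -[RHS]map_id; apply/eq_in_map => x /sW.
  by move=> xs /=; rewrite transpK.
apply: uniq_perm; rewrite ?filter_uniq //.
  rewrite map_inj_in_uniq ?filter_uniq // => s s'.
  rewrite !mem_filter !path_leq0 => /andP[/andP[ss _] sW] /andP[/andP[ss' _] s'W].
  move=> /perm_sortP e; apply: (sorted_eq leq_trans anti_leq ss ss').
  rewrite -(trK s) // -(trK s') //; apply: perm_map; apply: e.
  - exact: leq_total.
  - exact: leq_trans.
  - exact: anti_leq.
move=> z; rewrite mem_filter path_leq0; apply/mapP/idP => [[s]|].
  rewrite mem_filter => /andP[/andP[_ cs] sW] ->; rewrite fW // -covE // cs.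
  by rewrite (sort_sorted leq_total).
move=> /andP[/andP[sz bz] zW].
pose s := sort leq (map (transp r k) z).
have sW : s \in W.
  move/WP: zW => [zd zW]; apply/WP; rewrite size_sort size_map; split=> // x.
  rewrite mem_sort mulnC => /mapP[y /zW ys ->]; apply: transp_leq => //.
  by rewrite mulnC.
have fs : f s = z.
  rewrite -[RHS](sorted_sort leq_trans sz) /f.
  apply/(perm_sortP leq_total leq_trans anti_leq).
  apply: (@perm_trans _ (map (transp k r) (map (transp r k) z))).
    by apply: perm_map; rewrite perm_sort.
  rewrite -map_comp -[X in perm_eq _ X]map_id.
  have -> // : map (transp k r \o transp r k) z = map id z.
  apply/eq_in_map => x xz /=; rewrite transpK // mulnC.
  by move/WP: zW => [_]; apply.
exists s; rewrite ?fs // mem_filter sW andbT covE // fs bz andbT path_leq0.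
exact: (sort_sorted leq_total).
Qed.

(** * Weakly increasing paths that skip no block *)

Definition up_step r (a b : nat) := (a <= b) && (b %/ r <= (a %/ r).+1).

Lemma path_up_step r c z : 0 < r -> path leq c z ->
  path (up_step r) c z <-> forall beta, c %/ r <= beta <= last c z %/ r ->
    has (fun y => y %/ r == beta) (c :: z).
Proof.
move=> r0; elim: z c => [|b z IH] c /=.
  by move=> _; split=> // _ beta; rewrite -eqn_leq orbF.
move=> /andP[cb bz]; have := IH b bz => IHb.
have bl x : x \in b :: z -> b <= x.
  rewrite inE => /orP[/eqP -> //|].
  by move: bz; rewrite (path_sortedE leq_trans) => /andP[/allP bz _ /bz].
have cbr : c %/ r <= b %/ r by rewrite leq_div2r.
rewrite /up_step cb /=; split=> [/andP[st /IHb h] beta bb|h].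
  have [bb'|bb'] := leqP (b %/ r) beta; first by apply/orP; right; apply: h; lia.
  by have -> : c %/ r == beta by lia.
apply/andP; split.
  (* A longer jump would miss the block right after that of c for good, as all later letters are at
     least b. *)
  rewrite leqNgt; apply/negP => lt.
  have [||] := (@orP _ _ (h (c %/ r).+1 _)).
  - have : b <= last b z by apply: bl; rewrite mem_last.
    by move/(leq_div2r r); lia.
  - by rewrite ltn_eqF.
  move=> /(hasP (s := b :: z))[x /bl xb /eqP e].
  by have := leq_div2r r xb; lia.
apply/IHb => beta bb.
have := h beta; rewrite (leq_trans cbr) /=; last by lia.
move=> /(_ ltac:(lia))/orP[/eqP e|//].
by apply/orP; left; lia.
Qed.

(** With values at most [r * k], block k can only be hit by ending at [r * k]; the rest is
    [path_up_step] for blocks 0 to k. *)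
Lemma blocks_up_step k r z : 0 < r -> (forall x, x \in z -> x <= r * k) ->
  path leq 0 z && hits_blocks k r (0 :: z) =
  path (up_step r) 0 z && (last 0 z == r * k).
Proof.
move=> r0 zk; have lz : last 0 z <= r * k.
  by have := mem_last 0 z; rewrite inE => /orP[/eqP ->|/zk].
apply/andP/andP => [[pz hz]|[pz /eqP lz']]; last first.
  have pz' : path leq 0 z by apply: sub_path pz => a b /andP[].
  split=> //; apply/allP => beta; rewrite mem_iota add0n ltnS => /= bk.
  by apply: (proj1 (path_up_step r0 pz')) => //; rewrite lz' mulKn // div0n bk.
have le : last 0 z = r * k.
  apply/eqP; rewrite eqn_leq lz /=.
  have /hasP[x] : has (fun x => x %/ r == k) (0 :: z).
    by apply: (allP hz); rewrite mem_iota add0n ltnS leqnn.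
  move=> xz /eqP xk.
  have xrk : r * k <= x by rewrite mulnC -leq_divRL // xk.
  apply: leq_trans xrk _; move: xz; rewrite inE => /orP[/eqP -> //|xz].
  have [i i_z <-] := nthP 0 xz.
  have := pz; rewrite path_leq0 => /(sorted_leq_nth leq_trans leqnn 0).
  move=> /(_ i (size z).-1); rewrite !inE nth_last; apply=> //; case: (size z) i_z => //.
rewrite le eqxx; split=> //; apply/(path_up_step r0 pz) => beta.
rewrite le mulKn // => /andP[_ bk]; apply: (allP hz).
by rewrite mem_iota add0n ltnS bk.
Qed.

(* Number of [up_step]-paths of length d from w to r * k. *)
Fixpoint npaths r d w k : nat :=
  if d is d'.+1 then \sum_(w <= a < r) npaths r d' a k +
    (if k is k'.+1 then \sum_(0 <= a < r) npaths r d' a k' else 0)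
  else (w == 0) && (k == 0).

Lemma npaths0 r d w : w < r -> npaths r d w 0 = (w == 0).
Proof.
elim: d w => [|d IH] w wr /=; first by rewrite andbT.
rewrite addn0 big_ltn // IH // big_nat big1 ?addn0 // => a /andP[wa ar].
by rewrite IH // gtn_eqF // (leq_ltn_trans _ wa).
Qed.

Lemma npaths_gt r d w k : d < k -> npaths r d w k = 0.
Proof.
elim: d w k => [|d IH] w [|k] //= dk; first by rewrite andbF.
by rewrite !big1 // => a _; rewrite IH // ltnW.
Qed.

Lemma sum_nat_vanish (h : nat -> nat) N M : N <= M ->
  (forall a, N <= a -> h a = 0) -> \sum_(0 <= a < M) h a = \sum_(0 <= a < N) h a.
Proof.
move=> NM h0; rewrite (big_cat_nat (leq0n N) NM) /= [X in _ + X]big_nat.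
by rewrite [X in _ + X]big1 ?addn0 // => a /andP[/h0].
Qed.

(** From offset w in block j a step leads to an offset >= w in block j or to any offset in block j +
    1. This is the recursion of [npaths], with k - j blocks left to climb. *)
Lemma sum_up_step_npaths r M d j w k : 0 < r -> r * k < M -> w < r ->
  \sum_(s <- words (iota 0 M) d)
    (path (up_step r) (j * r + w) s && (last (j * r + w) s == r * k)) =
  if j <= k then npaths r d w (k - j) else 0.
Proof.
move=> r0 kM; elim: d j w => [|d IH] j w wr.
  rewrite big_seq1 /=; case: leqP => jk; last first.
    by case: eqP => //; nia.
  by rewrite subn_eq0; case: eqP; case: eqP; case: leqP => //; nia.
pose C a := \sum_(s <- words (iota 0 M) d)
  (path (up_step r) a s && (last a s == r * k)).
have C0 a : r * k < a -> C a = 0.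
  move=> ka; rewrite /C big1 // => s _.
  have [/= ps|//] := boolP (path (up_step r) a s).
  have : a <= last a s.
    elim: s (a) ps => [|b s IHs] c //= /andP[/andP[cb _] /IHs]; exact: leq_trans.
  by case: eqP => // ->; lia.
rewrite sum_wordsS.
transitivity (\sum_(0 <= a < M) up_step r (j * r + w) a * C a).
  rewrite /index_iota subn0; apply: eq_bigr => a _; rewrite /C big_distrr.
  by apply: eq_bigr => s _; rewrite /= mulnb andbA.
pose h a := up_step r (j * r + w) a * C a.
have h0 a : r * k < a -> h a = 0 by move=> /C0 e; rewrite /h e muln0.
rewrite -/h (sum_nat_vanish kM) //.
(* The range is enlarged past both bounds beyond which h vanishes, so that it can next be cut at
   [j.+2 * r], the end of block j + 1. *)
rewrite -(@sum_nat_vanish h _ (j.+2 * r + (r * k).+1)) ?leq_addl //.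
have hlow a : a < j * r + w -> h a = 0.
  by move=> lt; rewrite /h /up_step leqNgt lt.
have hhigh a : j.+2 * r <= a -> h a = 0.
  rewrite -leq_divRL // => lt; rewrite /h /up_step divnMDl // (divn_small wr).
  by rewrite addn0 [_ %/ r <= _]leqNgt lt andbF.
rewrite (@sum_nat_vanish h (j.+2 * r)) ?leq_addr //.
have c1 : j * r + w <= j.+1 * r by rewrite mulSn addnC leq_add2r ltnW.
have c2 : j.+1 * r <= j.+2 * r by rewrite leq_mul2r leqnSn orbT.
rewrite (big_cat_nat (leq0n (j * r + w)) (leq_trans c1 c2)) /=.
rewrite [X in X + _]big_nat [X in X + _]big1 ?add0n; last by move=> a /andP[_ /hlow].
rewrite (big_cat_nat c1 c2) /=.
have e1 : \sum_(j * r + w <= a < j.+1 * r) h a = \sum_(w <= a < r) C (j * r + a).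
  rewrite [j * r + w]addnC big_addn mulSn addnK; apply: eq_big_nat => a /andP[wa ar].
  rewrite (addnC a) /h /up_step leq_add2l wa !divnMDl // (divn_small wr).
  rewrite (divn_small ar) addn0 leqnSn.
  by rewrite mul1n.
have e2 : \sum_(j.+1 * r <= a < j.+2 * r) h a = \sum_(0 <= a < r) C (j.+1 * r + a).
  rewrite -{1}[j.+1 * r]add0n big_addn -mulnBl subSnn mul1n.
  apply: eq_big_nat => a ar.
  rewrite (addnC a) /h /up_step !divnMDl // (divn_small wr).
  rewrite (divn_small ar) !addn0 leqnn andbT.
  have -> : j * r + w <= j.+1 * r + a by lia.
  by rewrite mul1n.
rewrite e1 e2 /=.
have -> : \sum_(w <= a < r) C (j * r + a) =
    if j <= k then \sum_(w <= a < r) npaths r d a (k - j) else 0.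
  case: ifP => jk; last first.
    by rewrite big_nat big1 // => a /andP[_ ar]; rewrite /C IH // jk.
  by apply: eq_big_nat => a /andP[_ ar]; rewrite /C IH // jk.
have -> : \sum_(0 <= a < r) C (j.+1 * r + a) =
    if j < k then \sum_(0 <= a < r) npaths r d a (k - j.+1) else 0.
  case: ifP => jk; last first.
    by rewrite big_nat big1 // => a /andP[_ ar]; rewrite /C IH // jk.
  by apply: eq_big_nat => a /andP[_ ar]; rewrite /C IH // jk.
case: ltngtP => jk //.
  by case E : (k - j) => [|m]; [lia | rewrite subnS E].
by rewrite -jk subnn.
Qed.

(** * The local h-polynomial *)

Section CountFaces.

Variables (n r : nat) (F : {set 'I_n}).
Hypothesis r_gt0 : 0 < r.

Let Gamma_F := restriction (edgewise n r) (@edgewise_carrier n r) F.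

Definition set_mask : bitseq := [seq i \in F | i <- enum 'I_n].

Lemma size_set_mask : size set_mask = n.
Proof. by rewrite size_map size_enum_ord. Qed.

Lemma nth_set_mask (i : 'I_n) : nth false set_mask i = (i \in F).
Proof. by rewrite (nth_map i) ?size_enum_ord // nth_ord_enum. Qed.

Lemma count_set_mask : count id set_mask = #|F|.
Proof. by rewrite count_map -size_filter cardE enumT; congr size; apply: eq_filter. Qed.

Let face_seq k (s : seq nat) := mask_path set_mask 0 s && covers k r (0 :: s).

Lemma face_seqP k s : size s = n -> (forall x, x \in s -> x <= r * k) ->
  face_seq k s -> let g := nth 0 (0 :: s) in
  [/\ forall i, i < n -> g i <= g i.+1, g n = r * k,
      forall beta, beta < k -> exists2 i, i <= n & g i %% k = beta &
      forall i : 'I_n, i \notin F -> g i.+1 = g i].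
Proof.
move=> sn srk /andP[/mask_pathP hm /andP[rks res]] g.
have {}hm (i : 'I_n) : if i \in F then g i <= g i.+1 else g i.+1 == g i.
  rewrite -nth_set_mask; apply: hm; first by rewrite size_set_mask.
  by rewrite sn.
have gS i : i < n -> g i <= g i.+1.
  by move=> i_n; have := hm (Ordinal i_n) => /=; case: ifP => // _ /eqP ->.
have gmono i j : i <= j -> j <= n -> g i <= g j.
  elim: j => [|j IH]; first by rewrite leqn0 => /eqP ->.
  rewrite leq_eqVlt => /orP[/eqP -> //|ij] jn.
  exact: leq_trans (IH ij (ltnW jn)) (gS j jn).
split=> //.
- apply/eqP; rewrite eqn_leq; apply/andP; split.
    have : g n \in 0 :: s by apply: mem_nth; rewrite /= sn.
    by rewrite inE => /orP[/eqP -> //|/srk].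
  have [i] := nthP 0 rks; rewrite /= sn ltnS => i_n <-.
  exact: gmono.
- move=> beta bk; have /(allP res)/hasP[x xs /eqP <-] : beta \in iota 0 k.
    by rewrite mem_iota.
  by have [i] := nthP 0 xs; rewrite /= sn ltnS => i_n <-; exists i.
- by move=> i iF; have := hm i; rewrite (negbTE iF) => /eqP.
Qed.

Lemma chain_of_ext k (g g' : nat -> nat) : (forall i, i <= n -> g i = g' i) ->
  chain_of n r k g = chain_of n r k g'.
Proof.
move=> e; apply/setP => b; rewrite !inE; apply: eq_existsb => j.
by apply: eq_forallb => i; rewrite e // -ltnS.
Qed.

(** Summing the prefix sums over a face and forming [chain_of] are mutually inverse. *)
Lemma nfaces_face_seq k : 0 < k ->
  nfaces Gamma_F k = \sum_(s <- words (iota 0 (r * k).+1) n) face_seq k s.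
Proof.
move=> k0; pose T := [set t : n.-tuple 'I_(r * k).+1 | face_seq k [seq val x | x <- t]].
pose g (t : n.-tuple 'I_(r * k).+1) := nth 0 (0 :: [seq val x | x <- t]).
have gP t : t \in T ->
    [/\ forall i, i < n -> g t i <= g t i.+1, g t n = r * k,
      forall beta, beta < k -> exists2 i, i <= n & g t i %% k = beta &
      forall i : 'I_n, i \notin F -> g t i.+1 = g t i].
  rewrite inE => /face_seqP; apply; first by rewrite size_map size_tuple.
  by move=> x /mapP[y _ ->]; rewrite -ltnS ltn_ord.
have gtnth t i (i_n : i < n) : g t i.+1 = tnth t (Ordinal i_n).
  by rewrite (tnth_nth ord0) /g /= (nth_map ord0) ?size_tuple.
transitivity #|T|; last first.
  apply: etrans (big_tuple_words n (r * k).+1 (fun s => face_seq k s : nat)).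
  by rewrite -sum1_card big_mkcond; apply: eq_bigr => t _; rewrite inE.
rewrite -(card_in_imset (f := fun t => chain_of n r k (g t))) => [|t t' tT t'T e].
  congr #|pred_of_set _|; apply/setP => E; rewrite inE [E \in Gamma_F]inE.
  apply/idP/imsetP.
    move=> /andP[/andP[Eedge EF] /eqP Ek].
    (* Entry i is the sum at i + 1; the sum at 0 is always 0 and is not stored. *)
    pose t : n.-tuple 'I_(r * k).+1 := [tuple inord (\sum_(a in E) pre a i.+1) | i < n].
    have sumle i : \sum_(a in E) pre a i <= r * k.
      by rewrite -Ek mulnC -sum_nat_const leq_sum // => a _; apply: pre_leq.
    have gE i : i <= n -> g t i = \sum_(a in E) pre a i.
      case: i => [|i] i_n; first by rewrite big1 // => a _; rewrite pre0.
      by rewrite gtnth tnth_mktuple /= inordK // ltnS.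
    exists t; last by rewrite (chain_of_ext _ gE) chain_of_face.
    have sz : size [seq val x | x <- t] = n by rewrite size_map size_tuple.
    rewrite inE; apply/andP; split.
      apply/mask_pathP; first by rewrite size_set_mask sz.
      rewrite sz => i i_n.
      change (if nth false set_mask i then g t i <= g t i.+1 else g t i.+1 == g t i).
      rewrite (gE i.+1 i_n) (gE i (ltnW i_n)).
      rewrite -[i]/(val (Ordinal i_n)) nth_set_mask; case: ifP => iF.
        by apply: leq_sum => a _; rewrite (preS a (Ordinal i_n)) leq_addr.
      apply/eqP; apply: eq_bigr => a aE; apply/eqP; move: EF; rewrite carrier_subset.
      move=> /forallP/(_ a)/implyP/(_ aE)/forallP/(_ (Ordinal i_n))/implyP; apply.
      by rewrite iF.
    have gmem i : i <= n -> g t i \in 0 :: [seq val x | x <- t].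
      by move=> i_n; apply: mem_nth; rewrite /= sz ltnS.
    apply/andP; split.
      have := gmem n (leqnn n); rewrite gE //.
      have -> // : \sum_(a in E) pre a n = r * k.
      by rewrite -Ek mulnC -sum_nat_const; apply: eq_bigr => a _; apply: pre_full.
    apply/allP => beta; rewrite mem_iota add0n => /andP[_ bk].
    have [i i_n ei] := face_residues Eedge Ek bk.
    by apply/hasP; exists (g t i); [apply: gmem | rewrite gE // ei].
  move=> [t tT ->]; have [gS gn gres goff] := gP t tT.
  rewrite chain_of_edgewise // card_chain_of // eqxx andbT /= carrier_subset.
  apply/forallP => b; apply/implyP => /chain_ofP[j jk bE].
  apply/forallP => i; apply/implyP => /goff gi.
  by rewrite !bE ?gi // ltnW.
(* Injectivity: [sum_chain_of] recovers the sequence from its chain. *)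
have [gS gn gres _] := gP t tT; have [gS' gn' gres' _] := gP t' t'T.
have eg i : i <= n -> g t i = g t' i.
  move=> i_n; rewrite -(sum_chain_of k0 gS _ gn gres i_n) //.
  by rewrite -(sum_chain_of k0 gS' _ gn' gres' i_n) // e.
apply/val_inj/(inj_map val_inj)/(@eq_from_nth _ 0).
  by rewrite !size_map !size_tuple.
by move=> i; rewrite size_map size_tuple => i_n; apply: (eg i.+1).
Qed.

(** The forced positions outside F are dropped, residues are traded for blocks by transposition, and
    the remaining sequences are block paths. The empty face, k = 0, is treated apart. *)
Lemma nfaces_npaths k : nfaces Gamma_F k = npaths r #|F| 0 k.
Proof.
have [->|k0] := posnP k.
  rewrite npaths0 // /nfaces -[RHS](cards1 (set0 : {set Vr n r})).
  congr #|pred_of_set _|; apply/setP => E; rewrite !inE cards_eq0.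
  apply: andb_idl => /eqP ->; apply/andP; split.
    by apply/forallP => a; rewrite inE.
  by rewrite /edgewise_carrier big_set0 sub0set.
rewrite nfaces_face_seq //.
transitivity (\sum_(s <- words (iota 0 (r * k).+1) #|F|)
   path leq 0 s * covers k r (0 :: s)).
  rewrite -count_set_mask -sum_mask_path ?iota_uniq ?mem_iota // size_set_mask.
  rewrite big_seq_cond [RHS]big_seq_cond; apply: eq_bigr => s /andP[sW _].
  rewrite /face_seq mulnb; have [ps|//] /= := boolP (mask_path _ _ _).
  congr nat_of_bool; apply: covers_mem; apply: mask_path_mem => //.
  by rewrite size_set_mask (size_words_mem sW).
under eq_bigr do rewrite mulnb.
rewrite sum_covers_blocks //.
have := @sum_up_step_npaths r (r * k).+1 #|F| 0 0 k r_gt0 (leqnn _) r_gt0.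
rewrite mul0n addn0 subn0 leq0n => <-.
rewrite big_seq_cond [RHS]big_seq_cond; apply: eq_bigr => s /andP[sW _].
by rewrite blocks_up_step // => x xs; have [_ /(_ x xs)] := words_iota0P _ _ _ sW.
Qed.

End CountFaces.

Local Open Scope ring_scope.

(** * From face numbers to the h-polynomials and their alternating sum *)

Section LocalH.

Variables (R : realType) (r : nat).
Hypothesis r_gt0 : (0 < r)%N.

Let P : {poly R} := \sum_(0 <= k < r) 'X^k.

(** Splitting off the first step, a step inside the block gives a factor 1 - X and a step to the
    next block a factor X, which rearranges to [Eop_step_desc]. *)
Lemma sum_npaths d w : (w < r)%N ->
  \sum_(k < d.+1) (npaths r d w k)%:R *: ('X^k * (1 - 'X) ^+ (d - k)) =
  Eop r ('X^w * P ^+ d).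
Proof.
elim: d w => [|d IH] w wr.
  rewrite big_ord_recl big_ord0 addr0 /= !expr0 !mulr1 EopXn_small // andbT.
  by rewrite scaler_nat.
pose U a := Eop r ('X^a * P ^+ d).
have IHU a b : (b <= r)%N -> \sum_(k < d.+1)
    (\sum_(a <= i < b) npaths r d i k)%:R *: ('X^k * (1 - 'X) ^+ (d - k)) =
    \sum_(a <= i < b) U i.
  move=> br; under eq_bigr do rewrite natr_sum scaler_suml.
  rewrite exchange_big /=; apply: eq_big_nat => i /andP[_ ib].
  by rewrite IH // (leq_trans ib).
rewrite exprS /P Eop_step_desc // -/P.
have -> : \sum_(k < d.+2) (npaths r d.+1 w k)%:R *: ('X^k * (1 - 'X) ^+ (d.+1 - k)) =
    (1 - 'X) * (\sum_(w <= i < r) U i) + 'X * (\sum_(0 <= i < r) U i).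
  under eq_bigr do rewrite /= natrD scalerDl.
  rewrite big_split /=; congr (_ + _).
    have z : (\sum_(w <= i < r) npaths r d i d.+1 = 0)%N.
      by rewrite big1 // => i _; rewrite npaths_gt.
    rewrite big_ord_recr /= z scale0r addr0.
    rewrite -IHU // mulr_sumr; apply: eq_bigr => k _.
    by rewrite (subSn (leq_ord k)) exprS -scalerAr mulrCA.
  rewrite big_ord_recl /= scale0r add0r -IHU // mulr_sumr; apply: eq_bigr => k _.
  by rewrite /bump leq0n add1n subSS exprS -scalerAr mulrA.
(* Offsets >= w get total weight (1 - X) + X = 1, offsets < w only X. *)
rewrite [X in 'X * X](big_cat_nat (leq0n w) (ltnW wr)) /=.
by rewrite -/(U _); ring.
Qed.

Lemma hpoly_restriction n (F : {set 'I_n}) :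
  hpoly R #|F| (restriction (edgewise n r) (@edgewise_carrier n r) F) =
  Eop r (P ^+ #|F|).
Proof.
rewrite /hpoly; under eq_bigr do rewrite nfaces_npaths //.
by rewrite sum_npaths // expr0 mul1r.
Qed.

Lemma local_hpoly_edgewise n :
  local_hpoly (edgewise n r) (@edgewise_carrier n r) R =
  Eop r ((\sum_(1 <= k < r) 'X^k) ^+ n).
Proof.
have -> : \sum_(1 <= k < r) 'X^k = P - 1 :> {poly R}.
  by rewrite /P [in RHS]big_ltn // expr0 [X in X - 1]addrC addrK.
(* Expanding the n factors, F records those from which P is chosen. *)
have -> : (P - 1) ^+ n = \sum_(F : {set 'I_n}) (-1) ^+ (n - #|F|) * P ^+ #|F|.
  transitivity (\prod_(i < n) (P - 1)); first by rewrite big_const_ord iter_mulr_1.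
  rewrite bigA_distr; apply: eq_big => // F _.
  rewrite (bigID (mem F)) /= mulrC; congr (_ * _).
    rewrite (eq_bigr (fun=> -1)); last by move=> i /negbTE ->.
    rewrite (eq_bigl (fun i => i \in ~: F)) => [|i]; last by rewrite in_setC.
    by rewrite prodr_const cardsCs setCK card_ord.
  by rewrite (eq_bigr (fun=> P)) ?prodr_const // => i ->.
rewrite /local_hpoly linear_sum card_ord /=; apply: eq_bigr => F _.
(* The sign is a polynomial and [Eop] is linear only over R, so the two parities are separated. *)
rewrite hpoly_restriction; case: (odd _) (signr_odd {poly R} (n - #|F|)) => <-.
  by rewrite expr1 !mulN1r linearN.
by rewrite expr0 !mul1r.
Qed.

End LocalH.

Theorem theorem4p4 (R : realType) (n r : nat) (hn : (1 <= n)%N) (hr : (1 <= r)%N) :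
  [/\ local_hpoly (edgewise n r) (@edgewise_carrier n r) R =
        Eop r ((\sum_(1 <= k < r) 'X^k) ^+ n : {poly R}),
      Eop r ((\sum_(1 <= k < r) 'X^k) ^+ n : {poly R}) =
        \sum_(w in SW n r) 'X^(asc w) &
      \sum_(w in SW n r) 'X^(asc w) =
        \sum_(i < n./2.+1) (xi n r i)%:R *: ('X^i * (1 + 'X) ^+ (n - 2 * i))
          :> {poly R}].
Proof.
split; first exact: local_hpoly_edgewise.
- by rewrite Eop_asc_sum0 // sum_SW_asc.
- by rewrite sum_SW_asc // asc_sum_after sum_after_gamma // sum_xi.
Qed.
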